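(* There is a constant $c>0$ such that the following holds. For each integer $d \ge 2$ let $\sigma = \sigma(d) \in (0,1]$ and let $n = n(d)$ be a positive integer such that $$\frac{n\,\sigma^{4/3}}{d\log d} \longrightarrow \infty \quad\text{as } d\to\infty$$ (that is, $n = \omega(d\log d)/\sigma^{4/3}$). For each $d$ let $M = M_d \in \mathbb{R}^{d\times n}$ be an arbitrary deterministic matrix all of whose columns have Euclidean norm at most $1$, and let $R = R_d \in \mathbb{R}^{d\times n}$ be a random matrix with i.i.d. entries distributed as $\mathcal{N}(0,\sigma^2/d)$. Then $$\Pr_R\big[\mathrm{disc}(M+R) \le d^{-c}\big] \longrightarrow 1 \quad\text{as } d\to\infty .$$
   Context: For a matrix $A\in\mathbb{R}^{d\times n}$, its discrepancy is $\mathrm{disc}(A) = \min_{x\in\{-1,1\}^n}\|Ax\|_\infty$. $\log$ is the natural logarithm, and $\mathcal{N}(0,s^2)$ is the centered Gaussian distribution with variance $s^2$. A Komlós instance is a matrix in $\mathbb{R}^{d\times n}$ all of whose columns have Euclidean norm at most $1$. The asymptotic notation $\omega(\cdot)$, $o(\cdot)$ is with respect to $d\to\infty$. *)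

(* Defs.v *)
From mathcomp Require Import all_boot all_order all_algebra.
From mathcomp Require Import all_classical all_reals all_analysis.

Set Implicit Arguments.
Unset Strict Implicit.
Unset Printing Implicit Defensive.

Import Order.TTheory GRing.Theory Num.Theory.
Import numFieldNormedType.Exports.

Local Open Scope classical_set_scope.
Local Open Scope ring_scope.

Section discrepancy.
Context {R : realType} {d n : nat}.
Implicit Types A : 'M[R]_(d, n).

(* Points of {-1,1}^n are encoded by Boolean vectors, true standing for -1. *)
Definition sign_vec (b : {ffun 'I_n -> bool}) : 'cV[R]_n :=
  \col_j (-1) ^+ b j.

(* The library norm on matrices is the maximum of the absolute values of the
   entries, hence the sup norm on column vectors. The initial value of the
   iterated minimum is itself one of the values being minimized. *)
Definition disc A : R :=
  \big[Num.min/`|A *m sign_vec [ffun=> false]|]_(b : {ffun 'I_n -> bool})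
    `|A *m sign_vec b|.

Definition komlos A : Prop :=
  forall j, Num.sqrt (\sum_i A i j ^+ 2) <= 1.

End discrepancy.

Section random_matrix.
Context {R : realType} {disp : measure_display} {T : measurableType disp}.
Variable P : probability T R.

Definition mutually_independent (I : finType) (X : I -> {RV P >-> R}) : Prop :=
  forall (J : {set I}) (B : I -> set R),
    (forall i, i \in J -> measurable (B i)) ->
    P (\bigcap_(i in [set` J]) (X i @^-1` B i)) =
    (\prod_(i in J) P (X i @^-1` B i))%E.

(* [normal_prob m s] is parameterized by the standard deviation [s]. *)
Definition iid_gaussian (s : R) (I : finType) (X : I -> {RV P >-> R}) : Prop :=
  mutually_independent X /\
  forall i (B : set R), measurable B ->
    distribution P (X i) B = normal_prob 0 s B.

Definition random_mx d n (X : 'I_d * 'I_n -> {RV P >-> R}) (w : T) :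
  'M[R]_(d, n) := \matrix_(i, j) X (i, j) w.

End random_matrix.

(* Main.v *)
(** Second moment method over a non-uniform random colouring. The Gram-Schmidt
walk, run on the columns of M stacked over the identity, gives a random sign
vector x for which (x, M x) is jointly subgaussian; condition it on
|M x|^2 <= 64 d. With z = (M + R) x, average the Gaussian bumps
exp(- |z|^2 / t), t = 2 / n^4, over x, each divided by its expectation over R.
This average Z has mean 1, and Z > 1/2 forces some colouring of discrepancy at
most 1/d. Write y for an independent copy of x. The sums of R over the
coordinates where x and y agree and where they differ are independent Gaussians,
so E Z^2 is the exact average of
  (1 - r^2)^(- d / 2) exp ((r <M x, M y> - r^2 (|M x|^2 + |M y|^2) / 2) / (a (1 - r^2))),
where a is about sigma^2 n / d and r is about <x, y> / n. By subgaussianity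
<x, y> is of order sqrt n and <M x, M y> of order sqrt d, and the exponent is
o(1) exactly when n >> d / sigma^(4/3); the rare event |r| > 1/2 has probability
exp (- c n), which beats the trivial bound exp (O (d log n)) because
n >> d log d. *)

Require Import Defs.
From HB Require Import structures.
From mathcomp Require Import all_boot all_order all_algebra.
From mathcomp Require Import ring lra.
From mathcomp Require Import all_classical all_reals all_analysis.
From mathcomp Require Import measurable_realfun.

Set Implicit Arguments.
Unset Strict Implicit.
Unset Printing Implicit Defensive.

Import Order.TTheory GRing.Theory Num.Theory.
Import numFieldNormedType.Exports.

Local Open Scope classical_set_scope.
Local Open Scope ring_scope.

(** * Two-point laws *)

(** A uniform colouring fails because |M x|^2 may then be of order n, much larger than d; the walk
    keeps it of order d for every Komlos matrix. Orders of magnitude: r is about n^(-1/2), <M x, M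
    y> about d^(1/2) and a about sigma^2 n / d, so the exponent is about (d / n)^(3/2) / sigma^2,
    whence the power 4/3. The prefactor (1 - r^2)^(- d / 2) needs only n >> d; the logarithm is
    spent on the rare event alone. Gaussian bumps replace indicators because convolution with R
    keeps their form, so that both moments are exact. Dividing by the expectation turns the second
    moment into a likelihood ratio between correlated and independent Gaussians, equal to 1 when r =
    0. The width t is a compromise: small enough that a bump value that is not tiny forces |z| <=
    1/d, large enough that a / t is polynomial in n, which keeps the worst ratio at exp (O (d log
    n)). *)

Section two_point_law.
Context {R : realType}.
Implicit Types z s t b : R.

(* [bern_mgf z] and [cbern_mgf z] are the moment generating functions of the law
   on {-1, 1} with mean [z], plain and centered. *)
Definition bern_mgf z s : R := ((1 + z) * expR s + (1 - z) * expR (- s)) / 2.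

Definition cbern_mgf z s : R := expR (- (z * s)) * bern_mgf z s.

Lemma bern_mgf_gt0 z s : -1 <= z <= 1 -> 0 < bern_mgf z s.
Proof.
move=> /andP[z1 z2]; rewrite /bern_mgf.
have := expR_gt0 s; have := expR_gt0 (- s).
move: (expR s) (expR (- s)) => b a a0 b0.
suff h : 0 < (1 + z) * b + (1 - z) * a by lra.
have [z0|z0] := leP 0 z.
  by rewrite ltr_pwDl ?mulr_gt0 ?mulr_ge0 ?(ltW a0) //; lra.
by rewrite ltr_wpDl ?mulr_gt0 ?mulr_ge0 ?(ltW b0) //; lra.
Qed.

Lemma cbern_mgf_gt0 z s : -1 <= z <= 1 -> 0 < cbern_mgf z s.
Proof. by move=> h; rewrite mulr_gt0 ?expR_gt0 ?bern_mgf_gt0. Qed.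

(** Jensen's inequality for a centered law: the tangent line of the exponential at 0 averages to
    1. *)
Lemma cbern_mgf_ge1 z s : -1 <= z <= 1 -> 1 <= cbern_mgf z s.
Proof.
move=> /andP[z1 z2]; rewrite /cbern_mgf /bern_mgf mulrA mulrDr.
rewrite !(mulrCA (expR _)) -!expRD.
have h1 := expR_ge1Dx (- (z * s) + s); have h2 := expR_ge1Dx (- (z * s) - s).
have k1 : (1 + z) * (1 + (- (z * s) + s)) <= (1 + z) * expR (- (z * s) + s).
  by apply: ler_wpM2l => //; lra.
have k2 : (1 - z) * (1 + (- (z * s) - s)) <= (1 - z) * expR (- (z * s) - s).
  by apply: ler_wpM2l => //; lra.
by rewrite ler_pdivlMr //; lra.
Qed.

Lemma inv_onem_le_expR (y : R) : 0 <= y <= 1 / 4 -> (1 - y)^-1 <= expR (2 * y).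
Proof.
move=> y0; rewrite -div1r ler_pdivrMr; last lra.
by have e1 := expR_ge1Dx (2 * y); nra.
Qed.

(** The sharp constant is 1/2. With 2, the case s >= 1/2 is s <= 2 s^2, and below 1/2 the bounds 1 /
    (1 - s) and 1 / (1 + s) of the two exponentials average to 1 / (1 - s^2). *)
Lemma half_expRD_le s : (expR s + expR (- s)) / 2 <= expR (2 * s ^+ 2).
Proof.
wlog s0 : s / 0 <= s => [wl|].
  have [s0|s0] := leP 0 s; first exact: wl.
  by have := wl (- s); rewrite opprK sqrrN addrC; apply; lra.
have [s1|s1] := leP (1 / 2) s.
  apply: (@le_trans _ _ (expR s)); last by rewrite ler_expR; nra.
  have : expR (- s) <= expR s by rewrite ler_expR; lra.
  by lra.
have i1 : expR s <= (1 - s)^-1.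
  rewrite -[s in X in X <= _]opprK expRN lef_pV2 ?posrE ?expR_gt0 //; last lra.
  by have := expR_ge1Dx (- s).
have i2 : expR (- s) <= (1 + s)^-1.
  rewrite expRN lef_pV2 ?posrE ?expR_gt0 ?expR_ge1Dx //; lra.
have y0 : 0 <= s ^+ 2 <= 1 / 4 by apply/andP; split; nra.
have i3 := inv_onem_le_expR y0.
apply: le_trans i3.
have -> : (1 - s ^+ 2)^-1 = ((1 - s)^-1 + (1 + s)^-1) / 2.
  by field; apply/andP; split; [|apply/andP; split]; apply: lt0r_neq0; nra.
lra.
Qed.

(* Symmetrization: multiply by [cbern_mgf z (- s) >= 1]. *)
Lemma cbern_mgf_le z s : -1 <= z <= 1 -> cbern_mgf z s <= expR (4 * s ^+ 2).
Proof.
move=> h; have h1 := cbern_mgf_ge1 (- s) h.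
have h0 := cbern_mgf_gt0 s h.
apply: (@le_trans _ _ (cbern_mgf z s * cbern_mgf z (- s))).
  by rewrite ler_peMr // ltW.
apply: (@le_trans _ _ (((expR s + expR (- s)) / 2) ^+ 2)).
  rewrite /cbern_mgf mulrACA -expRD mulrN subrr expR0 mul1r /bern_mgf opprK.
  have k : 0 <= (z * (expR s - expR (- s))) ^+ 2 by exact: sqr_ge0.
  by lra.
have -> : 4 * s ^+ 2 = 2 * s ^+ 2 + 2 * s ^+ 2 by ring.
rewrite expRD expr2; apply: ler_pM; rewrite ?half_expRD_le //;
  by rewrite divr_ge0 // addr_ge0 // expR_ge0.
Qed.

(** The mean of the two-point law after reweighting by exp (b x), which is also the logarithmic
    derivative of [bern_mgf z] at b. *)
Let tilt z b := ((1 + z) * expR b - (1 - z) * expR (- b)) / 2 / bern_mgf z b.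

Let tilt_itv z b : -1 <= z <= 1 -> -1 <= tilt z b <= 1.
Proof.
move=> h; have D0 := bern_mgf_gt0 b h.
rewrite /tilt ler_pdivlMr // ler_pdivrMr //; move: h => /andP[z1 z2].
rewrite /bern_mgf.
have := expR_gt0 b; have := expR_gt0 (- b).
move: (expR b) (expR (- b)) => x y x0 y0.
apply/andP; split; nra.
Qed.

(** Reweighting by exp ((b + t) x) is reweighting by exp (b x), then by exp (t x). A shift of b thus
    costs a drift linear in t and the centered generating function of another two-point law. *)
Let cbern_mgf_tilt z b t : -1 <= z <= 1 ->
  cbern_mgf z (b + t) =
  cbern_mgf z b * expR ((tilt z b - z) * t) * cbern_mgf (tilt z b) t.
Proof.
move=> h; have D0 := bern_mgf_gt0 b h.
have e1 : (1 + tilt z b) * bern_mgf z b = (1 + z) * expR b.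
  by rewrite /tilt mulrDl divfK ?lt0r_neq0 // /bern_mgf; field.
have e2 : (1 - tilt z b) * bern_mgf z b = (1 - z) * expR (- b).
  by rewrite /tilt mulrBl divfK ?lt0r_neq0 // /bern_mgf; field.
have eD : bern_mgf z (b + t) = bern_mgf z b * bern_mgf (tilt z b) t.
  have -> : bern_mgf z b * bern_mgf (tilt z b) t =
      ((1 + tilt z b) * bern_mgf z b * expR t +
       (1 - tilt z b) * bern_mgf z b * expR (- t)) / 2.
    by rewrite [in LHS]/(bern_mgf (tilt z b) t); ring.
  by rewrite e1 e2 /bern_mgf opprD !expRD; ring.
have eE : expR (- (z * (b + t))) =
    expR (- (z * b)) * expR ((tilt z b - z) * t) * expR (- (tilt z b * t)).
  by rewrite -!expRD; congr expR; ring.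
by rewrite /cbern_mgf eD eE; ring.
Qed.

Let tilt_sub z b : -1 <= z <= 1 ->
  tilt z b - z = (1 - z ^+ 2) * (expR b - expR (- b)) / 2 / bern_mgf z b.
Proof.
move=> h; have D0 := bern_mgf_gt0 b h.
apply: (mulIf (lt0r_neq0 D0)); rewrite divfK ?lt0r_neq0 // mulrBl /tilt.
by rewrite divfK ?lt0r_neq0 // /bern_mgf; field.
Qed.

(** The slope of the mean in b is a variance, hence at most 1; the cruder factor 4 matches the
    exponent of [cbern_mgf_le]. *)
Let tilt_ge z b : -1 <= z <= 1 -> 0 <= b -> 0 <= tilt z b - z <= 4 * b.
Proof.
move=> h b0; have D0 := bern_mgf_gt0 b h.
rewrite tilt_sub // ler_pdivrMr // divr_ge0 ?(ltW D0) //=; last first.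
  rewrite divr_ge0 // mulr_ge0 //; first by move: h => /andP[]; nra.
  by rewrite subr_ge0 ler_expR; lra.
rewrite /bern_mgf.
have e1 : expR (- b) = expR b * expR (- b - b).
  by rewrite -expRD; congr expR; ring.
have := expR_ge1Dx (- b - b); have := expR_gt0 b; have := expR_gt0 (- b).
have : 0 < expR (- b - b) by exact: expR_gt0.
rewrite {}e1; move: (expR b) (expR _) => x y y0 _ x0 hy.
have k1 : x * (1 - y) <= 2 * b * x by nra.
move: h => /andP[z1 z2].
have k2 : (1 - z ^+ 2) * (x * (1 - y)) <= 2 * (1 + z) * (2 * b * x).
  have -> : 1 - z ^+ 2 = (1 - z) * (1 + z) by ring.
  have u0 : 0 <= 2 * b * x by rewrite !mulr_ge0 // ltW.
  apply: (@le_trans _ _ ((1 - z) * (1 + z) * (2 * b * x))).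
    by apply: ler_wpM2l => //; nra.
  by apply: ler_wpM2r => //; nra.
have k3 : 0 <= 4 * b * ((1 - z) * (x * y)).
  by rewrite !mulr_ge0 //; [lra|exact: ltW|exact: ltW].
nra.
Qed.

Let tilt_le z b : -1 <= z <= 1 -> b <= 0 -> 4 * b <= tilt z b - z <= 0.
Proof.
move=> h b0.
have h' : -1 <= - z <= 1 by lra.
have := @tilt_ge (- z) (- b) h' ltac:(lra).
have -> : tilt (- z) (- b) = - tilt z b.
  have eD : bern_mgf (- z) (- b) = bern_mgf z b.
    by rewrite /bern_mgf !opprK; ring.
  by rewrite /tilt eD !opprK; ring.
lra.
Qed.

Lemma cbern_mgf_shift_ge z b t : -1 <= z <= 1 -> 0 <= b * t ->
  cbern_mgf z (b + t) <= cbern_mgf z b * expR (4 * (b * t + t ^+ 2)).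
Proof.
move=> h bt; rewrite cbern_mgf_tilt // -mulrA ler_pM2l ?cbern_mgf_gt0 //.
rewrite mulrDr expRD; apply: ler_pM;
  [exact: expR_ge0|exact/ltW/cbern_mgf_gt0/tilt_itv| |exact/cbern_mgf_le/tilt_itv].
rewrite ler_expR; have [b0|b0] := leP 0 b.
  have /andP[m0 m1] := tilt_ge h b0; have [t0|t0] := leP 0 t; first by nra.
  have b0' : b <= 0 by rewrite -(nmulr_lge0 b t0).
  have -> : tilt z b - z = 0 by lra.
  by rewrite (_ : b = 0) ?(mul0r, mulr0) //; lra.
have /andP[m0 m1] := tilt_le h (ltW b0); have [t0|t0] := leP 0 t; last by nra.
have t0' : t <= 0 by rewrite -(nmulr_rge0 t b0).
have -> : t = 0 by lra.
by rewrite !mulr0.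
Qed.

(** The mean drifts in the direction of b, so when t opposes b the drift term only helps and the
    quadratic term alone remains. *)
Lemma cbern_mgf_shift_le z b t : -1 <= z <= 1 -> b * t <= 0 ->
  cbern_mgf z (b + t) <= cbern_mgf z b * expR (4 * t ^+ 2).
Proof.
move=> h bt; rewrite cbern_mgf_tilt // -mulrA ler_pM2l ?cbern_mgf_gt0 //.
rewrite -[X in _ <= X]mul1r; apply: ler_pM;
  [exact: expR_ge0|exact/ltW/cbern_mgf_gt0/tilt_itv| |exact/cbern_mgf_le/tilt_itv].
rewrite -[leRHS]expR0 ler_expR.
have [->|bN0] := eqVneq b 0.
  have /andP[] := tilt_ge h (lexx 0); rewrite mulr0 => m0 m1.
  by rewrite (_ : tilt z 0 - z = 0) ?mul0r //; lra.
have [b0|b0] := leP 0 b.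
  have {}b0 : 0 < b by rewrite lt_def bN0.
  have /andP[m0 m1] := tilt_ge h (ltW b0).
  have t0 : t <= 0 by rewrite -(pmulr_rle0 t b0).
  by nra.
have /andP[m0 m1] := tilt_le h (ltW b0).
have t0 : 0 <= t by rewrite -(nmulr_rle0 t b0).
by nra.
Qed.

End two_point_law.

(** * Orthogonal projections *)

Section least_squares.
Context {R : realType} {N n : nat}.
Implicit Types (u v : 'rV[R]_N) (w : 'I_n -> 'rV[R]_N) (A B : {set 'I_n}).

Definition dotv u v : R := \sum_i u 0 i * v 0 i.

Lemma dotvC u v : dotv u v = dotv v u.
Proof. by apply: eq_bigr => i _; rewrite mulrC. Qed.

Lemma dotvDl u u' v : dotv (u + u') v = dotv u v + dotv u' v.
Proof. by rewrite -big_split; apply: eq_bigr => i _; rewrite mxE mulrDl. Qed.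

Lemma dotvZl (a : R) u v : dotv (a *: u) v = a * dotv u v.
Proof. by rewrite mulr_sumr; apply: eq_bigr => i _; rewrite mxE mulrA. Qed.

Lemma dotvNl u v : dotv (- u) v = - dotv u v.
Proof. by rewrite -scaleN1r dotvZl mulN1r. Qed.

Lemma dotvBl u u' v : dotv (u - u') v = dotv u v - dotv u' v.
Proof. by rewrite dotvDl dotvNl. Qed.

Lemma dotv0l v : dotv 0 v = 0.
Proof. by rewrite -(scale0r 0) dotvZl mul0r. Qed.

Lemma dotvDr u v v' : dotv u (v + v') = dotv u v + dotv u v'.
Proof. by rewrite dotvC dotvDl ![dotv _ u]dotvC. Qed.

Lemma dotvBr u v v' : dotv u (v - v') = dotv u v - dotv u v'.
Proof. by rewrite dotvC dotvBl ![dotv _ u]dotvC. Qed.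

Lemma dotvZr (a : R) u v : dotv u (a *: v) = a * dotv u v.
Proof. by rewrite dotvC dotvZl dotvC. Qed.

Lemma dotv_suml (I : Type) (r : seq I) (P : pred I) (F : I -> 'rV[R]_N) v :
  dotv (\sum_(i <- r | P i) F i) v = \sum_(i <- r | P i) dotv (F i) v.
Proof.
apply: (big_morph (fun u => dotv u v)); last exact: dotv0l.
by move=> u u'; rewrite dotvDl.
Qed.

Lemma dotvv_ge0 u : 0 <= dotv u u.
Proof. by apply: sumr_ge0 => i _; rewrite -expr2 sqr_ge0. Qed.

Lemma dotvv_eq0 u : dotv u u = 0 -> u = 0.
Proof.
move=> /eqP; rewrite psumr_eq0 => [/allP h|i _]; last by rewrite -expr2 sqr_ge0.
apply/rowP => i; rewrite mxE; apply/eqP.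
by have := h i (mem_index_enum _); rewrite /= mulf_eq0 orbb.
Qed.

Definition comb w (c : 'I_n -> R) : 'rV[R]_N := \sum_j c j *: w j.

Definition in_span w A u : Prop :=
  exists c : 'I_n -> R, (forall j, j \notin A -> c j = 0) /\ u = comb w c.

Lemma combD w (c c' : 'I_n -> R) : comb w (fun j => c j + c' j) = comb w c + comb w c'.
Proof. by rewrite -big_split; apply: eq_bigr => j _; rewrite scalerDl. Qed.

Lemma combZ w (a : R) (c : 'I_n -> R) : comb w (fun j => a * c j) = a *: comb w c.
Proof. by rewrite scaler_sumr; apply: eq_bigr => j _; rewrite scalerA. Qed.

Lemma comb_delta w i : comb w (fun j => (j == i)%:R) = w i.
Proof.
rewrite /comb (bigD1 i) //= eqxx scale1r big1 ?addr0 // => j /negbTE ->.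
by rewrite scale0r.
Qed.

Lemma in_span0 w A : in_span w A 0.
Proof.
exists (fun=> 0); split=> //.
by rewrite /comb big1 // => j _; rewrite scale0r.
Qed.

Lemma in_spanD w A u v : in_span w A u -> in_span w A v -> in_span w A (u + v).
Proof.
move=> [c [hc ->]] [c' [hc' ->]]; exists (fun j => c j + c' j); split.
  by move=> j jA; rewrite hc // hc' // addr0.
by rewrite combD.
Qed.

Lemma in_spanZ w A a u : in_span w A u -> in_span w A (a *: u).
Proof.
move=> [c [hc ->]]; exists (fun j => a * c j); split.
  by move=> j jA; rewrite hc // mulr0.
by rewrite combZ.
Qed.

Lemma in_spanB w A u v : in_span w A u -> in_span w A v -> in_span w A (u - v).
Proof. by move=> hu hv; rewrite -scaleN1r; apply/in_spanD/in_spanZ. Qed.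

Lemma in_span_gen w A j : j \in A -> in_span w A (w j).
Proof.
move=> jA; exists (fun i => (i == j)%:R); rewrite comb_delta; split=> // i.
by apply: contraNeq; case: (i =P j) => [-> //|_]; rewrite eqxx.
Qed.

Lemma in_spanS w A B u : A \subset B -> in_span w A u -> in_span w B u.
Proof.
move=> /fintype.subsetP AB [c [hc ->]]; exists c; split=> // j jB.
by apply: hc; apply: contra jB; exact: AB.
Qed.

Definition orth_to w A u := forall j, j \in A -> dotv u (w j) = 0.

Lemma orth_to_span w A u v : orth_to w A u -> in_span w A v -> dotv u v = 0.
Proof.
move=> hu [c [hc ->]]; rewrite dotvC dotv_suml big1 // => j _.
have [jA|jA] := boolP (j \in A); last by rewrite hc // scale0r dotv0l.
by rewrite dotvZl dotvC hu // mulr0.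
Qed.

Lemma orth_toS w A B u : A \subset B -> orth_to w B u -> orth_to w A u.
Proof. by move=> /fintype.subsetP AB h j /AB /h. Qed.

(** Gram-Schmidt by induction on the size of A: project on the span of all generators but one, then
    correct along the part of the last one orthogonal to them. The generators may be dependent, and
    then this part is zero and nothing is corrected. *)
Lemma exists_proj w A v : exists2 u, in_span w A u & orth_to w A (v - u).
Proof.
elim: {A}#|A| {-2}A (leqnn #|A|) v => [|m IH] A mA v.
  move: mA; rewrite leqn0 cards_eq0 => /eqP ->.
  by exists 0; [exact: in_span0|move=> j; rewrite inE].
have [->|[i iA]] := set_0Vmem A.
  by apply: IH; rewrite cards0.
have cA : (#|A :\ i| <= m)%N by move: mA; rewrite (cardsD1 i) iA.
have [u hu ov] := IH _ cA v; have [y hy oy] := IH _ cA (w i).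
have sA : A :\ i \subset A := finset.subD1set A i.
have hb : in_span w A (w i - y).
  by apply: in_spanB; [exact: in_span_gen|exact: in_spanS hy].
have oby : dotv (w i - y) y = 0 by exact: orth_to_span hy.
have [b0|b0] := eqVneq (dotv (w i - y) (w i - y)) 0.
  exists u; first exact: in_spanS hu.
  move=> j jA; have [->|ji] := eqVneq j i; last by apply: ov; rewrite !inE ji.
  have /subr0_eq -> := dotvv_eq0 b0; exact: orth_to_span hy.
pose t := dotv (v - u) (w i - y) / dotv (w i - y) (w i - y).
exists (u + t *: (w i - y)).
  by apply: in_spanD; [exact: in_spanS hu|exact: in_spanZ].
move=> j jA; rewrite opprD addrA dotvBl dotvZl.
have [->|ji] := eqVneq j i.
  have h x : dotv x y = 0 -> dotv x (w i) = dotv x (w i - y).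
    by move=> xy; rewrite [RHS]dotvC dotvBl -[dotv y x]dotvC xy subr0 dotvC.
  by rewrite !h ?(orth_to_span ov hy) // /t divfK // subrr.
by rewrite (ov j) ?(oy j) ?inE ?ji ?jA // mulr0 subrr.
Qed.

Definition proj w A v : 'rV[R]_N := sval (cid2 (exists_proj w A v)).

Lemma proj_in w A v : in_span w A (proj w A v).
Proof. by rewrite /proj; case: cid2. Qed.

Lemma proj_orth w A v : orth_to w A (v - proj w A v).
Proof. by rewrite /proj; case: cid2. Qed.

Definition proj_sq w A v : R := dotv (proj w A v) (proj w A v).

Lemma dotv_proj w A u v : in_span w A u -> dotv u v = dotv u (proj w A v).
Proof.
move=> hu; apply/eqP; rewrite -subr_eq0 dotvC [X in _ - X]dotvC -dotvBl.
by rewrite (orth_to_span (@proj_orth w A v) hu).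
Qed.

(** Expand |u - P v|^2 >= 0. The squared projection is a maximum over test vectors u of the span, so
    every later lower bound on it reduces to choosing u. *)
Lemma proj_sq_lb w A u v : in_span w A u -> 2 * dotv u v - dotv u u <= proj_sq w A v.
Proof.
move=> hu; rewrite (dotv_proj v hu) /proj_sq.
have := dotvv_ge0 (u - proj w A v).
by rewrite dotvBl !dotvBr [dotv (proj w A v) u]dotvC; lra.
Qed.

Lemma proj_sq_le w A v : proj_sq w A v <= dotv v v.
Proof.
have := dotvv_ge0 (v - proj w A v); have := dotv_proj v (proj_in w A v).
rewrite dotvBl !dotvBr /proj_sq dotvC => ->; lra.
Qed.

Lemma proj_sq_ge0 w A v : 0 <= proj_sq w A v.
Proof. exact: dotvv_ge0. Qed.

(** The test vector is [proj w B v + c]; its cross term vanishes because c is orthogonal to the span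
    of B. *)
Lemma proj_sq_add w A B c v : B \subset A -> in_span w A c -> orth_to w B c ->
  proj_sq w B v + 2 * dotv c v - dotv c c <= proj_sq w A v.
Proof.
move=> BA hc oc; have hB := proj_in w B v.
have := proj_sq_lb v (in_spanD (in_spanS BA hB) hc).
have e1 := dotv_proj v hB; have e2 := orth_to_span oc hB.
rewrite !dotvDl !dotvDr.
rewrite [dotv (proj w B v) c]dotvC e2 e1 /proj_sq; lra.
Qed.

End least_squares.

(** * The Gram-Schmidt walk *)

Section gram_schmidt_walk.
Context {R : realType} {N n : nat}.
Variable w : 'I_n -> 'rV[R]_N.
Hypothesis w_le1 : forall j, dotv (w j) (w j) <= 1.
Implicit Types (v : 'rV[R]_N) (A B : {set 'I_n}) (x u : 'I_n -> R).

(** The direction in which the walk moves the signed sum: the part of the pivot vector orthogonal to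
    the other alive vectors. *)
Definition resid (p : 'I_n) A : 'rV[R]_N := w p - proj w (A :\ p) (w p).

Let resid_orth p A : orth_to w (A :\ p) (resid p A).
Proof. exact: proj_orth. Qed.

Let resid_in p A : p \in A -> in_span w A (resid p A).
Proof.
move=> pA; apply: in_spanB; first exact: in_span_gen.
exact: (in_spanS (finset.subD1set _ _) (proj_in _ _ _)).
Qed.

Let resid_gen p A : dotv (resid p A) (w p) = dotv (resid p A) (resid p A).
Proof.
rewrite {3}/resid dotvBr.
by rewrite (orth_to_span (@resid_orth p A) (proj_in _ _ _)) subr0.
Qed.

Let resid_le1 p A : dotv (resid p A) (resid p A) <= 1.
Proof.
apply: le_trans (w_le1 p); have := resid_gen p A.
have := dotvv_ge0 (w p - resid p A); move: (resid p A) => r.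
by rewrite dotvBl !dotvBr [dotv (w p) r]dotvC; lra.
Qed.

Let proj_sqS A B v : B \subset A -> proj_sq w B v <= proj_sq w A v.
Proof.
move=> BA.
have := @proj_sq_add _ _ _ w A B 0 v BA (in_span0 _ _) (fun j _ => dotv0l _).
by rewrite !dotv0l; lra.
Qed.

(** When the pivot freezes, the projection shrinks by enough to release the term - b^2 of the
    potential. The test vector is b times the residual, of norm at most 1. *)
Let proj_sq_resid p A v : p \in A ->
  proj_sq w (A :\ p) v + dotv (resid p A) v ^+ 2 <= proj_sq w A v.
Proof.
move=> pA; set b := dotv _ v.
have hc : in_span w A (b *: resid p A) by exact/in_spanZ/resid_in.
have oc : orth_to w (A :\ p) (b *: resid p A).
  by move=> j jA; rewrite dotvZl resid_orth // mulr0.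
have := proj_sq_add v (finset.subD1set _ _) hc oc.
rewrite !dotvZl !dotvZr -/b.
have := resid_le1 p A; move: (dotv _ (resid p A)) => r r1.
have : b ^+ 2 * r <= b ^+ 2 by rewrite ler_piMr // sqr_ge0.
lra.
Qed.

(* The potential [expR (4 (|P_A v|^2 - b^2)) * cbern_mgf z b], with [z] the value
   of the pivot [p] and [b] the pairing of [v] with its residual, survives the
   freezing of coordinates of the current pivot phase. When the residual changes
   by a vector [e] whose pairing with [v] has sign opposite to [b], the loss is
   paid by the component of [v] along [q b - P e], a vector of the span of [A]
   orthogonal to the span of [B]. *)
Let potential_mono p A B z v : B \subset A -> p \in B -> -1 <= z <= 1 ->
  expR (4 * (proj_sq w B v - dotv (resid p B) v ^+ 2)) *
    cbern_mgf z (dotv (resid p B) v) <=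
  expR (4 * (proj_sq w A v - dotv (resid p A) v ^+ 2)) *
    cbern_mgf z (dotv (resid p A) v).
Proof.
move=> BA pB hz; set b := resid p A; set b' := resid p B.
have pA : p \in A by exact: (fintype.subsetP BA).
pose e := b' - b; set s := dotv b v; set t := dotv e v.
have -> : dotv b' v = s + t.
  by rewrite /s /t -(dotvDl b e) /e addrCA subrr addr0.
have QBA := proj_sqS v BA.
have [st|st] := leP 0 (s * t).
  (* Same sign: - (s + t)^2 + (s t + t^2) = - s^2 - s t, already at most - s^2. *)
  rewrite mulrC; apply: le_trans (ler_wpM2r (expR_ge0 _) (cbern_mgf_shift_ge hz st)) _.
  rewrite -mulrA -expRD mulrC ler_pM2r ?cbern_mgf_gt0 // ler_expR; nra.
rewrite mulrC; apply: le_trans (ler_wpM2r (expR_ge0 _) (cbern_mgf_shift_le hz (ltW st))) _.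
rewrite -mulrA -expRD mulrC ler_pM2r ?cbern_mgf_gt0 // ler_expR.
(* Opposite signs: - (s + t)^2 + t^2 = - s^2 - 2 s t, so the larger projection must supply the
   excess - 2 s t. *)
suff key : proj_sq w B v - 2 * (s * t) <= proj_sq w A v by nra.
have sD : B :\ p \subset A :\ p by exact: finset.setSD.
have eE : e = proj w (A :\ p) (w p) - proj w (B :\ p) (w p).
  by rewrite /e /b /b' /resid opprB addrC addrA subrK.
have he : in_span w (A :\ p) e.
  by rewrite eE; apply: in_spanB; [exact: proj_in|exact: in_spanS (proj_in _ _ _)].
have be : dotv b e = 0 by exact: (orth_to_span (@resid_orth p A)).
have bB : orth_to w (B :\ p) b by apply: orth_toS (@resid_orth p A).
have eB : orth_to w (B :\ p) e.
  by move=> j jB; rewrite (dotvBl b' b) (bB j) // resid_orth // subrr.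
set P := dotv b b; set q := dotv e e.
have b'b' : dotv b' b' = P + q.
  have -> : b' = b + e by rewrite /e addrCA subrr addr0.
  by rewrite (dotvDl b) (dotvDr b b) (dotvDr e b) (dotvC e b) be addr0 add0r.
have Pq1 : P + q <= 1 by rewrite -b'b' resid_le1.
have P0 : 0 < P.
  rewrite lt_def dotvv_ge0 andbT; apply: contraTneq st => /dotvv_eq0 b0.
  by rewrite /s b0 dotv0l mul0r ltxx.
have q0 : 0 < q.
  rewrite lt_def dotvv_ge0 andbT; apply: contraTneq st => /dotvv_eq0 b0.
  by rewrite /t b0 dotv0l mulr0 ltxx.
have bw : dotv b (w p) = P by exact: resid_gen.
have ew : dotv e (w p) = q.
  by rewrite (dotvBl b' b) !resid_gen b'b' addrC addKr.
(* As P + q <= 1, the gain 2 <c, v> - |c|^2 is at least 2 r (q s - P t) - r^2 P q, and this r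
   maximizes that bound. *)
pose r := (q * s - P * t) / (P * q).
pose c := r *: (q *: b - P *: e).
have hc : in_span w A c.
  apply/in_spanZ/in_spanB; first exact/in_spanZ/resid_in.
  exact/in_spanZ/(in_spanS (finset.subD1set _ _) he).
have oc : orth_to w B c.
  move=> j jB; rewrite dotvZl (dotvBl (q *: b)) !dotvZl.
  have [->|jp] := eqVneq j p; first by rewrite bw ew [q * P]mulrC subrr mulr0.
  by rewrite bB ?eB ?inE ?jp // !mulr0 subrr mulr0.
have := proj_sq_add v BA hc oc.
have -> : dotv c v = r * (q * s - P * t).
  by rewrite dotvZl (dotvBl (q *: b)) !dotvZl.
have -> : dotv c c = r ^+ 2 * (P * q * (P + q)).
  rewrite dotvZl dotvZr (dotvBl (q *: b)) (dotvBr (q *: b)) (dotvBr (P *: e)).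
  rewrite !dotvZl !dotvZr (dotvC e b) be -/P -/q.
  by ring.
have Pq0 : 0 < P * q by exact: mulr_gt0.
have rE : r * (P * q) = q * s - P * t by rewrite /r divfK // lt0r_neq0.
rewrite -rE => h; apply: le_trans h.
have h1 : r ^+ 2 * (P * q * (P + q)) <= r ^+ 2 * (P * q).
  by rewrite ler_wpM2l ?sqr_ge0 // ler_piMr // ltW.
(* After clearing P q this reads (q s - P t)^2 + 4 P q s t = (q s + P t)^2 >= 0. *)
have h2 : - 4 * (s * t) <= r ^+ 2 * (P * q).
  rewrite -(ler_pM2r Pq0).
  have -> : r ^+ 2 * (P * q) * (P * q) = (r * (P * q)) ^+ 2 by ring.
  have := sqr_ge0 (q * s + P * t); rewrite rE; nra.
nra.
Qed.

Definition in_cube x : Prop := forall j, -1 <= x j <= 1.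
Definition alive x : {set 'I_n} := [set j | -1 < x j < 1]%SET.

Let exists_step x u p : in_cube x -> p \in alive x -> u p != 0 ->
  (forall j, j \notin alive x -> u j = 0) ->
  exists d : R, [/\ 0 < d, in_cube (fun j => x j + d * u j) &
    alive (fun j => x j + d * u j) \proper alive x].
Proof.
move=> hx pA up hu.
(* The time at which coordinate j reaches the face it moves towards; the step stops at the first
   such time. *)
pose t j := (if 0 < u j then 1 - x j else - 1 - x j) / u j.
case: (@Order.TotalTheory.arg_minP _ _ _ p (fun j => u j != 0) t up) => i ui imin.
have aliveu j : u j != 0 -> -1 < x j < 1.
  move=> uj; have : j \in alive x by apply: contraNT uj => /hu ->.
  by rewrite inE.
have tpos j : u j != 0 -> 0 < t j.
  move=> uj; have /andP[x1 x2] := aliveu j uj; rewrite /t; case: ifPn => [u0|].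
    by rewrite divr_gt0 // subr_gt0.
  rewrite -leNgt le_eqVlt (negbTE uj) /= => u0.
  by rewrite -mulrNN -invrN divr_gt0 ?oppr_gt0 //; lra.
exists (t i); split; first exact: tpos.
  move=> j; have [->|uj] := eqVneq (u j) 0; first by rewrite mulr0 addr0.
  have /andP[x1 x2] := aliveu j uj; have tij := imin j uj; have ti := tpos i ui.
  have [u0|u0] := ltP 0 (u j).
    have : t i * u j <= 1 - x j.
      have tj : t j = (1 - x j) / u j by rewrite /t u0.
      by rewrite -ler_pdivlMr // -tj.
    have : 0 <= t i * u j by rewrite mulr_ge0 // ltW.
    by move=> h1 h2; lra.
  have {}u0 : u j < 0 by rewrite lt_neqAle uj.
  have : -1 - x j <= t i * u j.
    have tj : t j = (-1 - x j) / u j by rewrite /t ltNge (ltW u0).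
    by rewrite -ler_ndivlMr // -tj.
  have : t i * u j <= 0 by rewrite mulr_ge0_le0 // ltW.
  by move=> h1 h2; lra.
rewrite properE; apply/andP; split.
  apply/fintype.subsetP => j; apply: contraLR => jA.
  by rewrite inE (hu j jA) mulr0 addr0; rewrite inE in jA.
apply/fintype.subsetPn; exists i; first by rewrite inE aliveu.
rewrite inE /t divfK //; case: ifP => _.
  by rewrite addrCA subrr addr0 ltxx andbF.
by rewrite addrCA subrr addr0 ltxx.
Qed.

Definition prob_weight (I : finType) (D : I -> R) : Prop :=
  (forall b, 0 <= D b) /\ \sum_b D b = 1.

Definition rounding_mgf (D : {ffun 'I_n -> bool} -> R) x v : R :=
  \sum_b D b * expR (dotv (comb w (fun j => (-1) ^+ b j - x j)) v).

(** If the pivot survives the step, its phase continues and [potential_mono] applies. If it froze,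
    its value is 1 or -1, its centered generating function is 1, and [proj_sq_resid] pays for the
    end of the phase. *)
Let rounding_next p x y : in_cube y -> p \in alive x -> alive y \subset alive x ->
  (exists2 D, prob_weight D &
     forall v, rounding_mgf D y v <= expR (4 * proj_sq w (alive y) v)) ->
  (p \in alive y -> exists2 D, prob_weight D & forall v, rounding_mgf D y v <=
     expR (4 * (proj_sq w (alive y) v - dotv (resid p (alive y)) v ^+ 2)) *
       cbern_mgf (y p) (dotv (resid p (alive y)) v)) ->
  exists2 D, prob_weight D & forall v, rounding_mgf D y v <=
     expR (4 * (proj_sq w (alive x) v - dotv (resid p (alive x)) v ^+ 2)) *
       cbern_mgf (y p) (dotv (resid p (alive x)) v).
Proof.
move=> hy px yx [D hD hDv] hp; have [py|py] := boolP (p \in alive y).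
  have [D' hD' hDv'] := hp py; exists D'; [exact: hD'|move=> v].
  by apply: le_trans (hDv' v) _; exact: potential_mono.
exists D; [exact: hD|move=> v]; apply: le_trans (hDv v) _.
have -> : forall s, cbern_mgf (y p) s = 1.
  move=> s; have : y p = 1 \/ y p = -1.
    have /andP[] := hy p; rewrite !le_eqVlt => /orP[/eqP <-|y1]; first by right.
    by case/orP => [/eqP ->|y2]; [left|move: py; rewrite inE y1 y2].
  rewrite /cbern_mgf /bern_mgf => -[|] ->.
    rewrite mul1r subrr mul0r addr0 mulrAC divff // mul1r -expRD addNr expR0 //.
  rewrite subrr mul0r add0r mulN1r opprK opprK mulrAC divff // mul1r -expRD.
  by rewrite subrr expR0.
rewrite mulr1 ler_expR ler_pM2l //.
have := proj_sq_resid v px.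
have sy : alive y \subset alive x :\ p.
  apply/fintype.subsetP => j jy; rewrite finset.in_setD1 (fintype.subsetP yx) // andbT.
  by apply: contraNneq py => <-.
by have := proj_sqS v sy; lra.
Qed.

Let rounding_mgf_step D x u v d :
  rounding_mgf D x v =
  expR (d * dotv (comb w u) v) * rounding_mgf D (fun j => x j + d * u j) v.
Proof.
rewrite /rounding_mgf mulr_sumr; apply: eq_bigr => b _.
rewrite mulrCA -expRD; congr (_ * expR _).
rewrite -dotvZl -combZ -dotvDl -combD; congr (dotv (comb w _) v).
by apply/funext => j; ring.
Qed.

Let rounding_mgf_mix (D1 D2 : {ffun 'I_n -> bool} -> R) (l1 l2 : R) x v :
  rounding_mgf (fun b => l1 * D1 b + l2 * D2 b) x v =
  l1 * rounding_mgf D1 x v + l2 * rounding_mgf D2 x v.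
Proof.
rewrite /rounding_mgf !mulr_sumr -big_split; apply: eq_bigr => b _ /=; ring.
Qed.

(* [expR (z b) * cbern_mgf z b] is affine in [z], so the two-point step of mean
   zero preserves the potential. *)
Let cbern_mgf_mix (z b d1 d2 : R) : 0 < d1 -> 0 < d2 ->
  d2 / (d1 + d2) * (expR (d1 * b) * cbern_mgf (z + d1) b) +
  d1 / (d1 + d2) * (expR (- d2 * b) * cbern_mgf (z - d2) b) = cbern_mgf z b.
Proof.
move=> d10 d20; rewrite /cbern_mgf !(mulrA (expR _)) -!expRD.
have -> : d1 * b - (z + d1) * b = - (z * b) by ring.
have -> : - d2 * b - (z - d2) * b = - (z * b) by ring.
by rewrite /bern_mgf; field; rewrite lt0r_neq0 // addr_gt0.
Qed.

(* A step of the walk moves [x] along [u] with [\sum_j u_j w_j = resid p A] until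
   some coordinate freezes. *)
Lemma rounding_exists m x : in_cube x -> (#|alive x| <= m)%N ->
  (exists2 D, prob_weight D &
     forall v, rounding_mgf D x v <= expR (4 * proj_sq w (alive x) v)) /\
  (forall p, p \in alive x -> exists2 D, prob_weight D & forall v, rounding_mgf D x v <=
     expR (4 * (proj_sq w (alive x) v - dotv (resid p (alive x)) v ^+ 2)) *
       cbern_mgf (x p) (dotv (resid p (alive x)) v)).
Proof.
elim: m x => [|m IH] x hx mx.
  have A0 : alive x = finset.set0 by apply/eqP; rewrite -cards_eq0 -leqn0.
  split; last by move=> p; rewrite A0 inE.
  pose b0 := [ffun j => x j == -1].
  exists (fun b => (b == b0)%:R).
    by split; [move=> b; exact: ler0n|rewrite (bigD1 b0) //= eqxx big1 ?addr0 // => b /negbTE ->].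
  move=> v; rewrite /rounding_mgf (bigD1 b0) //= eqxx big1 => [|b /negbTE ->];
    last by rewrite mul0r.
  rewrite addr0 mul1r ler_expR (_ : comb w _ = 0).
    by rewrite dotv0l mulr_ge0 ?proj_sq_ge0.
  rewrite /comb big1 // => j _; rewrite ffunE.
  have : j \notin alive x by rewrite A0 inE.
  have /andP[] := hx j; rewrite inE !le_eqVlt => /orP[/eqP <- _ _|y1].
    by rewrite eqxx subrr scale0r.
  case/orP => [/eqP ->|y2]; last by rewrite y1 y2.
  by rewrite (_ : 1 == -1 = false) ?subrr ?scale0r //; apply/eqP; lra.
(* The bound for a prescribed pivot is the real induction: a pivot must be kept until it freezes,
   and the first bound serves only between phases. *)
have second p : p \in alive x -> exists2 D, prob_weight D & forall v, rounding_mgf D x v <=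
     expR (4 * (proj_sq w (alive x) v - dotv (resid p (alive x)) v ^+ 2)) *
       cbern_mgf (x p) (dotv (resid p (alive x)) v).
  move=> px; have [c [c0 cE]] := proj_in w (alive x :\ p) (w p).
  pose u j := (j == p)%:R - c j.
  have uE : comb w u = resid p (alive x).
    rewrite /resid cE -(comb_delta w p) -scaleN1r -combZ -combD.
    by congr comb; apply/funext => j; rewrite mulN1r.
  have up : u p = 1 by rewrite /u eqxx c0 ?subr0 // !inE eqxx.
  have u0 j : j \notin alive x -> u j = 0.
    move=> jx; rewrite /u c0; last by rewrite finset.in_setD1 (negbTE jx) andbF.
    by rewrite subr0; case: eqP jx => // ->; rewrite px.
  (* Stated for a general direction because it is run along u and along - u, the two ends of the
     random step. *)
  have next u' : u' p != 0 -> (forall j, j \notin alive x -> u' j = 0) ->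
      exists d, 0 < d /\ exists2 D, prob_weight D & forall v,
      rounding_mgf D (fun j => x j + d * u' j) v <=
      expR (4 * (proj_sq w (alive x) v - dotv (resid p (alive x)) v ^+ 2)) *
       cbern_mgf (x p + d * u' p) (dotv (resid p (alive x)) v).
    move=> u'p u'0; have [d [d0 hd pd]] := exists_step hx px u'p u'0.
    exists d; split=> //.
    have md : (#|alive (fun j => (x j + d * u' j)%R)| <= m)%N.
      by rewrite -ltnS; apply: leq_trans (proper_card pd) _.
    have [h1 h2] := IH _ hd md.
    by apply: rounding_next => //; [exact: proper_sub|exact: h2].
  have [d1 [d10 [D1 [D10 D11] hD1]]] := next u ltac:(by rewrite up oner_eq0) u0.
  have [|j /u0 ->|d2 [d20 [D2 [D20 D21] hD2]]] := next (fun j => - u j).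
  - by rewrite up oppr_eq0 oner_eq0.
  - by rewrite oppr0.
  have d0 : 0 < d1 + d2 by exact: addr_gt0.
  exists (fun b => d2 / (d1 + d2) * D1 b + d1 / (d1 + d2) * D2 b).
    split; first by move=> b; rewrite addr_ge0 // mulr_ge0 // divr_ge0 // ltW.
    rewrite big_split -!mulr_sumr D11 D21 !mulr1 /= -mulrDl addrC divff //.
    by rewrite lt0r_neq0.
  move=> v; rewrite rounding_mgf_mix.
  rewrite (rounding_mgf_step D1 x u v d1) (rounding_mgf_step D2 x (fun j => - u j) v d2).
  set b := dotv (resid p _) v.
  have -> : dotv (comb w u) v = b by rewrite uE.
  have -> : dotv (comb w (fun j => - u j)) v = - b.
    rewrite /b -uE -dotvNl -scaleN1r -combZ; congr (dotv (comb w _) v).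
    by apply/funext => j; rewrite mulN1r.
  rewrite -(cbern_mgf_mix (x p) b d10 d20) mulrDr.
  have := hD1 v; have := hD2 v; rewrite up mulr1 mulrN1 -/b mulrN mulNr => k2 k1.
  have l1 : 0 <= d2 / (d1 + d2) by rewrite divr_ge0 // ltW.
  have l2 : 0 <= d1 / (d1 + d2) by rewrite divr_ge0 // ltW.
  apply: lerD; rewrite [leRHS]mulrCA ler_wpM2l //.
    by rewrite [leRHS]mulrCA ler_wpM2l ?expR_ge0.
  by rewrite [leRHS]mulrCA ler_wpM2l ?expR_ge0.
split=> //; have [A0|[p px]] := finset.set_0Vmem (alive x).
  have xm : (#|alive x| <= m)%N by rewrite A0 cards0.
  by have [] := IH x hx xm.
(* Choosing a new pivot is free: [cbern_mgf_le] contributes exp (4 b^2), which cancels the - b^2 of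
   the potential. *)
have [D hD hDv] := second p px; exists D; [exact: hD|move=> v]; apply: le_trans (hDv v) _.
have hz : -1 <= x p <= 1 by exact: hx.
apply: le_trans (ler_wpM2l (expR_ge0 _) (cbern_mgf_le _ hz)) _.
by rewrite -expRD ler_expR; lra.
Qed.

Lemma subgaussian_signs : exists2 D : {ffun 'I_n -> bool} -> R, prob_weight D &
  forall v, \sum_b D b * expR (dotv (comb w (fun j => (-1) ^+ b j)) v) <=
    expR (4 * dotv v v).
Proof.
have h0 : in_cube (fun=> 0) by move=> j; lra.
have [[D hD hDv] _] := rounding_exists h0 (leqnn _).
exists D; [exact: hD|move=> v]; apply: le_trans (le_trans (hDv v) _); last first.
  by rewrite ler_expR ler_pM2l ?proj_sq_le.
by apply: ler_sum => b _; under [in leRHS]eq_fun do rewrite subr0.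
Qed.

End gram_schmidt_walk.

(** * Gaussian integrals *)

Section gaussian_integrals.
Context {R : realType}.
Local Notation mu := (@lebesgue_measure R).

(** The Radon-Nikodym derivative of the normal law agrees almost everywhere with [normal_pdf], since
    both have the same integral over every measurable set. *)
Lemma ge0_integral_normal_prob (m s : R) (f : measurableTypeR R -> \bar R) :
  measurable_fun setT f -> (forall x, 0 <= f x)%E ->
  (\int[normal_prob m s]_x f x = \int[mu]_x (f x * (normal_pdf m s x)%:E))%E.
Proof.
move=> mf f0; have dom := normal_prob_dominates m s.
rewrite -(Radon_Nikodym_SigmaFinite.change_of_variables dom f0)//=.
have mpdf : measurable_fun setT (fun x => (normal_pdf m s x)%:E).
  by apply/measurable_EFinP; exact: measurable_normal_pdf.
have mrn : measurable_fun setT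
    (Radon_Nikodym_SigmaFinite.f (normal_prob m s) mu).
  exact: (measurable_int mu (Radon_Nikodym_SigmaFinite.f_integrable dom)).
apply: ae_eq_integral => //; [exact: emeasurable_funM|exact: emeasurable_funM|].
apply: ae_eqe_mul2l; apply: integral_ae_eq => //.
  exact: (Radon_Nikodym_SigmaFinite.f_integrable dom).
by move=> E _ mE; rewrite -(Radon_Nikodym_SigmaFinite.f_integral dom).
Qed.

(* Normalized as a heat kernel, up to [sqrt pi]. *)
Definition bump (v y : R) : R := expR (- (y ^+ 2 / v)) / Num.sqrt v.

Lemma bump_gt0 v y : 0 < v -> 0 < bump v y.
Proof. by move=> v0; rewrite divr_gt0 ?expR_gt0 ?sqrtr_gt0. Qed.

Lemma bumpN v y : bump v (- y) = bump v y.
Proof. by rewrite /bump sqrrN. Qed.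

Lemma measurable_bump v : measurable_fun setT (bump v).
Proof.
apply: measurable_funM => //; apply: measurableT_comp => //.
by apply: measurableT_comp => //; apply: measurable_funM => //.
Qed.

(* Completing the square, [bump v (y + t) * normal_pdf 0 s t] is
   [bump (v + 2 s^2) y] times the density of another normal law. *)
Lemma integral_bump_normal (s v y : R) : 0 < s -> 0 < v ->
  (\int[normal_prob 0 s]_t (bump v (y + t))%:E =
   (bump (v + 2 * s ^+ 2) y)%:E)%E.
Proof.
move=> s0 v0; rewrite ge0_integral_normal_prob; first last.
- by move=> t; rewrite lee_fin ltW ?bump_gt0.
- apply/measurable_EFinP; apply: (measurableT_comp (measurable_bump v)).
  exact: measurable_funD.
have s20 : 0 < s ^+ 2 by rewrite exprn_gt0.
pose V := v + 2 * s ^+ 2; have V0 : 0 < V by rewrite /V; lra.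
pose m' := - (2 * s ^+ 2 * y / V); pose s' := Num.sqrt (s ^+ 2 * v / V).
have s'20 : 0 < s ^+ 2 * v / V by rewrite divr_gt0 // mulr_gt0.
have s'0 : 0 < s' by rewrite sqrtr_gt0.
transitivity (\int[mu]_t ((bump V y)%:E * (normal_pdf m' s' t)%:E))%E.
  apply: eq_integral => t _; rewrite -!EFinM; congr EFin.
  rewrite !normal_pdfE ?lt0r_neq0 // /normal_peak /normal_fun /bump.
  have e1 : expR (- ((y + t) ^+ 2 / v)) * expR (- (t - 0) ^+ 2 / (s ^+ 2 *+ 2)) =
            expR (- (y ^+ 2 / V)) * expR (- (t - m') ^+ 2 / (s' ^+ 2 *+ 2)).
    rewrite -!expRD sqr_sqrtr ?(ltW s'20) //; congr expR.
    rewrite /m' /V; field.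
    by rewrite !lt0r_neq0 //= -/V.
  have e2 : (Num.sqrt v)^-1 * (Num.sqrt (s ^+ 2 * pi *+ 2))^-1 =
            (Num.sqrt V)^-1 * (Num.sqrt (s' ^+ 2 * pi *+ 2))^-1 :> R.
    rewrite -!invfM -!sqrtrM ?(ltW v0) ?(ltW V0) // sqr_sqrtr ?(ltW s'20) //.
    congr (Num.sqrt _)^-1; rewrite -!mulrnAr; field; exact: lt0r_neq0.
  rewrite mulrACA mulrCA.
  rewrite [LHS](_ : _ = ((Num.sqrt v)^-1 * (Num.sqrt (s ^+ 2 * pi *+ 2))^-1) *
    (expR (- ((y + t) ^+ 2 / v)) * expR (- (t - 0) ^+ 2 / (s ^+ 2 *+ 2)))); last by ring.
  by rewrite e1 e2; ring.
rewrite ge0_integralZl_EFin //; last first.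
- by rewrite ltW ?bump_gt0.
- by apply/measurable_EFinP; exact: measurable_normal_pdf.
- by move=> t _; rewrite lee_fin normal_pdf_ge0.
by rewrite integral_normal_pdf mule1.
Qed.

Lemma integral_expR_normal (a : R) :
  (\int[mu]_t (expR (a * t) * normal_pdf 0 1 t)%:E = (expR (a ^+ 2 / 2))%:E)%E.
Proof.
transitivity (\int[mu]_t ((expR (a ^+ 2 / 2))%:E * (normal_pdf a 1 t)%:E))%E.
  apply: eq_integral => t _; rewrite -EFinM; congr EFin.
  rewrite !normal_pdfE ?oner_eq0 // /normal_fun ![expR _ * (_ * _)]mulrCA -!expRD.
  by congr (_ * expR _); field.
rewrite ge0_integralZl_EFin ?expR_ge0 //; last 2 first.
- by move=> t _; rewrite lee_fin normal_pdf_ge0.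
- by apply/measurable_EFinP; exact: measurable_normal_pdf.
by rewrite integral_normal_pdf mule1.
Qed.

Lemma integral_expR_sqr_normal :
  (\int[mu]_t (expR (t ^+ 2 / 4) * normal_pdf 0 1 t)%:E = (Num.sqrt (2 : R))%:E)%E.
Proof.
have s20 : 0 < Num.sqrt (2 : R) by rewrite sqrtr_gt0.
transitivity (\int[mu]_t ((Num.sqrt (2 : R))%:E * (normal_pdf 0 (Num.sqrt 2) t)%:E))%E.
  apply: eq_integral => t _; rewrite -EFinM; congr EFin.
  rewrite !normal_pdfE ?oner_eq0 ?lt0r_neq0 // /normal_fun /normal_peak mulrCA -!expRD.
  rewrite mulrA sqr_sqrtr // expr1n mul1r; congr (_ * expR _); last by field.
  by rewrite -mulrnAr sqrtrM // invfM mulrA divff ?mul1r // lt0r_neq0.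
rewrite ge0_integralZl_EFin ?sqrtr_ge0 //; last 2 first.
- by move=> t _; rewrite lee_fin normal_pdf_ge0.
- by apply/measurable_EFinP; exact: measurable_normal_pdf.
by rewrite integral_normal_pdf mule1.
Qed.

Let measurable_expR_pdf (f : R -> R) : measurable_fun setT f ->
  measurable_fun setT (fun t => (expR (f t) * normal_pdf 0 1 t)%:E).
Proof.
move=> mf; apply/measurable_EFinP/measurable_funM; last exact: measurable_normal_pdf.
exact: measurableT_comp.
Qed.

(* Averaging the hypothesis over a normal [t] turns it into a bound on the
   exponential moment of [S^2]. *)
Lemma subgaussian_sqr (I : finType) (D S : I -> R) (K v : R) :
  (forall b, 0 <= D b) -> 0 <= K -> 0 < v ->
  (forall t, \sum_b D b * expR (t * S b) <= K * expR (v * t ^+ 2)) ->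
  \sum_b D b * expR (S b ^+ 2 / (8 * v)) <= K * Num.sqrt 2.
Proof.
move=> D0 K0 v0 hS; rewrite -lee_fin EFinM -integral_expR_sqr_normal.
(* Scaled so that v (r t)^2 = t^2 / 4, still integrable against the normal density, while averaging
   exp (r t S) yields exp (S^2 / (8 v)). *)
pose r := (2 * Num.sqrt v)^-1.
have rE : r ^+ 2 = (4 * v)^-1.
  by rewrite /r exprVn exprMn sqr_sqrtr ?(ltW v0) //; congr (_^-1); ring.
rewrite -sumEFin.
have -> : (\sum_(b : I) (D b * expR (S b ^+ 2 / (8 * v)))%:E =
    \sum_(b : I) \int[mu]_t ((D b)%:E * (expR ((r * S b) * t) * normal_pdf 0 1 t)%:E))%E.
  apply: eq_bigr => b _; rewrite ge0_integralZl_EFin //; last 2 first.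
  - by move=> t _; rewrite lee_fin mulr_ge0 ?expR_ge0 ?normal_pdf_ge0.
  - by apply: measurable_expR_pdf; exact: measurable_funM.
  rewrite integral_expR_normal EFinM exprMn rE; congr (_ * (expR _)%:E)%E.
  by field; exact: lt0r_neq0.
rewrite -ge0_integral_sum //; last 2 first.
- move=> b; apply: measurable_funeM; apply: measurable_expR_pdf; exact: measurable_funM.
- by move=> b t _; rewrite -EFinM lee_fin !mulr_ge0 ?expR_ge0 ?normal_pdf_ge0.
rewrite -ge0_integralZl_EFin //; last 2 first.
- by move=> t _; rewrite lee_fin mulr_ge0 ?expR_ge0 ?normal_pdf_ge0.
- by apply: measurable_expR_pdf; exact: measurable_funM.
apply: ge0_le_integral => //.
- by move=> t _; apply: sume_ge0 => b _; rewrite -EFinM lee_fin !mulr_ge0 ?expR_ge0 ?normal_pdf_ge0.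
- apply: emeasurable_sum => b; apply: measurable_funeM.
  by apply: measurable_expR_pdf; exact: measurable_funM.
- apply: measurable_funeM; apply: measurable_expR_pdf; exact: measurable_funM.
move=> t _.
under eq_bigr do rewrite -EFinM mulrA.
rewrite sumEFin -EFinM lee_fin -mulr_suml mulrA ler_wpM2r ?normal_pdf_ge0 //.
apply: le_trans (le_trans (hS (r * t)) _).
  by apply: ler_sum => b _; rewrite mulrAC.
rewrite exprMn rE (_ : v * _ = t ^+ 2 / 4) //; field; exact: lt0r_neq0.
Qed.

End gaussian_integrals.

(** * Independence *)

Section independent_integration.
Context {R : realType} {disp : measure_display} {T : measurableType disp}.
Variable P : probability T R.
Context {I : finType}.
Variable X : I -> {RV P >-> R}.
Hypothesis indepX : mutually_independent X.

Definition cylinders (J : {set I}) : set (set T) :=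
  [set A | exists2 B : I -> set R, (forall i, measurable (B i)) &
     A = \bigcap_(i in [set` J]) (X i @^-1` B i)].

Lemma cylinders_measurable J : cylinders J `<=` measurable.
Proof.
move=> A [B mB ->]; apply: fin_bigcap_measurable => // i _.
by rewrite -[X in measurable X]setTI; exact: measurable_funP.
Qed.

Lemma cylindersT J : cylinders J setT.
Proof.
exists (fun=> setT) => //; apply/esym; rewrite -subTset => w _ i _ //.
Qed.

Lemma cylinders_setI J : setI_closed (cylinders J).
Proof.
move=> A1 A2 [B1 mB1 ->] [B2 mB2 ->]; exists (fun i => B1 i `&` B2 i).
  by move=> i; exact: measurableI.
by rewrite -bigcapI.
Qed.

Lemma cylinders_preimage (J : {set I}) i B : i \in J -> measurable B ->
  cylinders J (X i @^-1` B).
Proof.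
move=> iJ mB; exists (fun j => if j == i then B else setT).
  by move=> j; case: ifP.
apply/seteqP; split => [w Bw j _|w /(_ i iJ)] /=; last by rewrite eqxx.
by case: eqP => [->|].
Qed.

(** The sample space with the sigma-algebra generated by the variables in J, made a type of its own
    so that product measures and Tonelli's theorem apply to [past J * R]. *)
Definition past (J : {set I}) := g_sigma_algebraType (cylinders J).

Lemma measurable_past (J : {set I}) i : i \in J ->
  measurable_fun setT (X i : past J -> R).
Proof.
move=> iJ _ B mB; rewrite setTI; apply: sub_sigma_algebra.
exact: cylinders_preimage.
Qed.

Let measurable_to_past J : measurable_fun setT (id : T -> past J).
Proof.
move=> _ B mB; rewrite setTI preimage_id.
exact: (smallest_sub (@sigma_algebra_measurable _ T) (@cylinders_measurable J)).
Qed.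

Let indep_cylinder (J : {set I}) i0 A B : i0 \notin J -> cylinders J A ->
  measurable B -> P (A `&` X i0 @^-1` B) = (P A * P (X i0 @^-1` B))%E.
Proof.
move=> iJ [C mC ->] mB.
pose C' i := if i == i0 then B else C i.
have CE i : i \in J -> C' i = C i.
  by rewrite /C' => iJ'; case: eqP iJ => // <-; rewrite iJ'.
have C'0 : C' i0 = B by rewrite /C' eqxx.
have := @indepX (i0 |: J)%SET C'.
rewrite (bigD1 i0) ?finset.setU11 //= C'0.
rewrite (eq_bigl (mem J)); last first.
  move=> i; rewrite finset.in_setU1; case: eqP => [->|] /=; last by rewrite andbT.
  by rewrite (negbTE iJ).
rewrite (eq_bigr (fun i => P (X i @^-1` C i))) => [|i iJ']; last by rewrite CE.
rewrite -indepX // muleC => <-; last by move=> i _; rewrite /C'; case: ifP.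
congr (P _); apply/seteqP; split => [w [h1 h2] i|w h] /=.
  rewrite finset.in_setU1 => /orP[/eqP ->|iJ']; first by rewrite C'0.
  by rewrite CE //; exact: h1.
split; last by have := h i0; rewrite /= finset.setU11 C'0; exact.
by move=> i iJ'; have := h i; rewrite /= finset.in_setU1 iJ' orbT CE //; exact.
Qed.

(** As functions of A, both sides are finite measures that agree on cylinders, a family closed under
    intersection, hence on the sigma-algebra it generates. *)
Let indep_past (J : {set I}) i0 A B : i0 \notin J -> <<s cylinders J >> A ->
  measurable B -> P (A `&` X i0 @^-1` B) = (P A * P (X i0 @^-1` B))%E.
Proof.
move=> iJ sA mB.
have mXB : measurable (X i0 @^-1` B).
  by rewrite -[X in measurable X]setTI; exact: measurable_funP.
have k0 : (0 <= fine (P (X i0 @^-1` B)))%R by rewrite fine_ge0.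
have kE : (fine (P (X i0 @^-1` B)))%:E = P (X i0 @^-1` B).
  by rewrite fineK // fin_num_measure.
have := @g_sigma_algebra_measure_unique _ R T (cylinders J)
  (@cylinders_measurable J) (fun=> setT) (fun=> @cylindersT J)
  ltac:(by rewrite bigcup_const) (mrestr P mXB) (mscale (NngNum k0) P)
  (@cylinders_setI J).
have mE C : mscale (NngNum k0) P C = (P (X i0 @^-1` B) * P C)%E.
  by rewrite /mscale /= kE.
move=> uniqP; rewrite muleC -mE; apply: uniqP => //.
- by move=> C cC; rewrite -[RHS]/(mscale (NngNum k0) P C) mE muleC -(indep_cylinder iJ).
- move=> _; apply: (@le_lt_trans _ _ 1%E); last exact: ltry.
  by rewrite [leLHS](_ : _ = P (setT `&` X i0 @^-1` B)) // setTI probability_le1.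
Qed.

(** Independence makes the joint law of the past and [X i0] a product measure; Tonelli's theorem
    then integrates [X i0] out first. *)
Lemma integral_indep (J : {set I}) i0 (F : past J * R -> \bar R) :
  i0 \notin J -> measurable_fun setT F -> (forall z, 0 <= F z)%E ->
  (\int[P]_w F (w, X i0 w) = \int[P]_w \int[distribution P (X i0)]_t F (w, t))%E.
Proof.
move=> iJ mF F0.
pose Y : {mfun T >-> past J} :=
  HB.pack (id : T -> past J) (isMeasurableFun.Build _ _ _ _ _ (@measurable_to_past J)).
have mW : measurable_fun setT (fun w => (w, X i0 w) : past J * R).
  apply: measurable_fun_pair; [exact: (@measurable_to_past J)|exact: measurable_funP].
pose W : {mfun T >-> (past J * R)%type} :=
  HB.pack (fun w : T => (w, X i0 w) : past J * R) (isMeasurableFun.Build _ _ _ _ _ mW).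
rewrite -[LHS](ge0_integral_distribution W mF F0).
have prodE := @product_measure_unique _ _ _ _ R (distribution P Y)
  (distribution P (X i0)) (distribution P W).
rewrite (eq_measure_integral (distribution P Y \x distribution P (X i0))%E); last first.
  move=> A mA _; apply/esym/prodE => // {A mA} A B mA mB.
  exact: (indep_past iJ mA mB).
rewrite fubini_tonelli1 //.
rewrite ge0_integral_distribution //; last first.
- by move=> w; exact: integral_ge0.
- exact: measurable_fun_fubini_tonelli_F.
Qed.

End independent_integration.

(* The library gives [R] and the carrier [measurableTypeR R] of [normal_prob]
   the same measurable sets but different displays. *)
Lemma integral_normal_rv {R : realType} {disp : measure_display}
    {T : measurableType disp} (P : probability T R) (Y : {RV P >-> R}) (m s : R)
    (f : R -> \bar R) :
  (forall B : set R, measurable B -> distribution P Y B = normal_prob m s B) ->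
  measurable_fun setT f -> (forall t, 0 <= f t)%E ->
  (\int[distribution P Y]_t f t = \int[normal_prob m s]_t f t)%E.
Proof.
move=> lawY mf f0.
have mY : measurable_fun setT (Y : T -> measurableTypeR R).
  have mY0 : measurable_fun setT Y by exact: measurable_funP.
  by move=> mT B mB; exact: (mY0 mT B mB).
pose Y' : {mfun T >-> measurableTypeR R} :=
  HB.pack (Y : T -> measurableTypeR R) (isMeasurableFun.Build _ _ _ _ _ mY).
rewrite ge0_integral_distribution //.
rewrite -(@eq_measure_integral _ (measurableTypeR R) R setT (normal_prob m s)
  (distribution P Y') f); last by move=> B mB _; exact: lawY.
by rewrite (@ge0_integral_distribution _ _ T (measurableTypeR R) R P Y' f).
Qed.

(** * Gaussian bumps of signed sums over disjoint groups of variables *)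

Section gaussian_linear_forms.
Context {R : realType} {disp : measure_display} {T : measurableType disp}.
Variable P : probability T R.
Context {I K : finType}.
Variables (X : I -> {RV P >-> R}) (s : R).
Hypotheses (s_gt0 : 0 < s) (iidX : iid_gaussian s X).
Variables (kappa : I -> K) (eps : I -> R) (p : K -> R) (u : R).
Hypotheses (eps1 : forall i, eps i = 1 \/ eps i = -1) (u_gt0 : 0 < u).
Implicit Type J : {set I}.

(** The state once the variables outside J are integrated out: [vr J k] is the current width of the
    bump of group k, and [lin J k] is what remains of its argument. *)
Let vr J k : R := u + 2 * s ^+ 2 * (\sum_(i in ~: J | kappa i == k) 1).

Let lin J k (w : T) : R :=
  p k + \sum_(i in J) (if kappa i == k then eps i * X i w else 0).

Let vr_gt0 J k : 0 < vr J k.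
Proof.
rewrite ltr_wpDr // mulr_ge0 ?sumr_ge0 //.
by rewrite mulr_ge0 ?sqr_ge0.
Qed.

Let vrU J i0 k : i0 \notin J ->
  vr J k = vr (i0 |: J)%SET k + (kappa i0 == k)%:R * (2 * s ^+ 2).
Proof.
move=> iJ; rewrite /vr 2!big_mkcondr /=.
rewrite (big_setD1 i0) ?finset.in_setC //=.
have -> : (~: (i0 |: J) = (~: J) :\ i0)%SET.
  by apply/setP => i; rewrite !inE negb_or.
case: eqP => _; rewrite ?mul1r ?mul0r ?addr0 ?add0r; last by [].
by ring.
Qed.

Let linU J i0 k w : i0 \notin J ->
  lin (i0 |: J)%SET k w = lin J k w + (kappa i0 == k)%:R * (eps i0 * X i0 w).
Proof.
move=> iJ; rewrite /lin (big_setU1 _ iJ) /=.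
case: eqP => _; rewrite ?mul1r ?mul0r ?addr0 ?add0r; last by [].
by ring.
Qed.

Let integral_bump_sign i0 v y : 0 < v ->
  (\int[distribution P (X i0)]_t (bump v (y + eps i0 * t))%:E =
   (bump (v + 2 * s ^+ 2) y)%:E)%E.
Proof.
move=> v0.
rewrite (integral_normal_rv (iidX.2 i0)); last 2 first.
- apply/measurable_EFinP; apply: (measurableT_comp (measurable_bump _)).
  by apply: measurable_funD => //; apply: measurable_funM.
- by move=> t; rewrite lee_fin; exact/ltW/bump_gt0.
case: (eps1 i0) => ->.
  by under eq_integral do rewrite mul1r; exact: integral_bump_normal.
under eq_integral do rewrite mulN1r -bumpN opprB addrC.
by rewrite integral_bump_normal // bumpN.
Qed.

(** Only the bump of the group of i0 depends on [X i0]; the other factors leave the inner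
    integral. *)
Let integral_step J i0 : i0 \notin J ->
  (\int[P]_w (\prod_k bump (vr (i0 |: J)%SET k) (lin (i0 |: J)%SET k w))%:E =
   \int[P]_w (\prod_k bump (vr J k) (lin J k w))%:E)%E.
Proof.
move=> iJ; set J' := (i0 |: J)%SET.
pose F (z : past X J * R) : \bar R := (\prod_k bump (vr J' k)
  (lin J k z.1 + (kappa i0 == k)%:R * (eps i0 * z.2)))%:E.
have F0 z : (0 <= F z)%E.
  by rewrite lee_fin prodr_ge0 // => k _; exact/ltW/bump_gt0.
have mlin k : measurable_fun setT (lin J k : past X J -> R).
  apply: measurable_funD => //.
  under eq_fun do rewrite big_mkcond.
  apply: measurable_sum => i; case: (boolP (i \in J)) => iJ' //.
  case: (kappa i == k) => //.
  by apply: measurable_funM => //; exact: measurable_past.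
have mF : measurable_fun setT F.
  apply/measurable_EFinP; apply: measurable_prod => k _.
  apply: (measurableT_comp (measurable_bump _)); apply: measurable_funD.
    exact: (measurableT_comp (mlin k) measurable_fst).
  by apply: measurable_funM => //; apply: measurable_funM.
transitivity (\int[P]_w F (w, X i0 w))%E.
  by apply: eq_integral => w _; congr EFin; apply: eq_bigr => k _; rewrite linU.
rewrite (integral_indep iidX.1 iJ mF F0); apply: eq_integral => w _.
rewrite (bigD1 (kappa i0)) //= mulrC EFinM (vrU _ iJ) eqxx mul1r.
rewrite -(integral_bump_sign i0) // -ge0_integralZl_EFin //; first last.
- by apply: prodr_ge0 => k _; exact/ltW/bump_gt0.
- apply/measurable_EFinP; apply: (measurableT_comp (measurable_bump _)).
  by apply: measurable_funD => //; apply: measurable_funM.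
- by move=> t _; rewrite lee_fin; exact/ltW/bump_gt0.
apply: eq_integral => t _; rewrite /F (bigD1 (kappa i0)) //= eqxx mul1r -EFinM.
congr EFin; rewrite mulrC; congr (_ * _); apply: eq_bigr => k; rewrite eq_sym => /negbTE kk.
by rewrite (vrU _ iJ) kk !mul0r !addr0.
Qed.

(* One variable is integrated out at a time, each adding [2 s^2] to the width of
   the bump of its group. *)
Lemma integral_prod_bump :
  (\int[P]_w (\prod_k bump u (p k + \sum_(i | kappa i == k) eps i * X i w))%:E =
   (\prod_k bump (u + 2 * s ^+ 2 * (\sum_(i | kappa i == k) 1)) (p k))%:E)%E.
Proof.
have main J : (\int[P]_w (\prod_k bump (vr J k) (lin J k w))%:E =
    (\prod_k bump (vr finset.set0 k) (p k))%:E)%E.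
  elim: {J}#|J| {-2}J (erefl #|J|) => [|m IH] J.
    move=> /cards0_eq ->; under eq_integral do under eq_bigr do rewrite /lin big_set0 addr0.
    rewrite integral_cst //.
    by rewrite [X in (_ * X)%E](_ : _ = 1%E) ?mule1 //; exact: probability_setT.
  have [->|[i iJ]] := finset.set_0Vmem J; first by rewrite cards0.
  rewrite (cardsD1 i) iJ => -[mJ].
  by rewrite -(IH _ mJ) -(@integral_step (J :\ i)%SET i) ?finset.setD11 // finset.setD1K.
have vT k : vr finset.setT k = u.
  rewrite /vr big1 ?mulr0 ?addr0 // => i.
  by rewrite finset.in_setC finset.in_setT.
have v0 k : vr finset.set0 k = u + 2 * s ^+ 2 * (\sum_(i | kappa i == k) 1).
  rewrite /vr; congr (_ + _ * _); apply: eq_bigl => i.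
  by rewrite finset.in_setC finset.in_set0.
have lT k w : lin finset.setT k w = p k + \sum_(i | kappa i == k) eps i * X i w.
  rewrite /lin big_mkcond [in RHS]big_mkcond; congr (_ + _).
  by apply: eq_bigr => i _; rewrite finset.in_setT.
under eq_bigr do rewrite -v0; rewrite -(main finset.setT).
by apply: eq_integral => w _; under [in RHS]eq_bigr do rewrite vT lT.
Qed.

End gaussian_linear_forms.

(** * The second moment method *)

Section second_moment.
Context {R : realType} {disp : measure_display} {T : measurableType disp}.
Variable P : probability T R.

(* Pointwise, [1_(~` E) + 8 Z <= 4 Z^2 + 4] where [Z] is the weighted sum; only
   integrals of nonnegative functions are then needed. *)
Lemma second_moment_method (I : finType) (D : I -> R) (g : I -> T -> R)
    (S : I -> I -> R) (eta : R) (E : set T) :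
  prob_weight D -> (forall b, measurable_fun setT (g b)) ->
  (forall b w, 0 <= g b w) ->
  (forall b, \int[P]_w (g b w)%:E = 1)%E ->
  (forall b c, \int[P]_w (g b w * g c w)%:E = (S b c)%:E)%E ->
  \sum_b D b * (\sum_c D c * S b c) <= 1 + eta ->
  measurable E -> (forall w, 1 / 2 < \sum_b D b * g b w -> E w) ->
  ((1 - 4 * eta)%:E <= P E)%E.
Proof.
move=> [D0 D1] mg g0 intg intgg hS mE ZE.
pose Z w := \sum_b D b * g b w.
have mZ : measurable_fun setT Z.
  by apply: measurable_sum => b; apply: measurable_funM.
have Z0 w : 0 <= Z w by apply: sumr_ge0 => b _; rewrite mulr_ge0.
have intZ : (\int[P]_w (Z w)%:E = 1)%E.
  under eq_integral do rewrite -sumEFin.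
  rewrite ge0_integral_sum //; last 2 first.
  - by move=> b; apply/measurable_EFinP; apply: measurable_funM.
  - by move=> b w _; rewrite lee_fin mulr_ge0.
  rewrite -[RHS]/(1%:E) -D1 -sumEFin; apply: eq_bigr => b _.
  under eq_integral do rewrite EFinM.
  rewrite ge0_integralZl_EFin ?intg ?mule1 //.
  - by move=> w _; rewrite lee_fin.
  - exact/measurable_EFinP.
have intZ2 : (\int[P]_w (Z w ^+ 2)%:E = (\sum_b D b * (\sum_c D c * S b c))%:E)%E.
  transitivity (\int[P]_w \sum_b \sum_c ((D b * D c)%:E * (g b w * g c w)%:E))%E.
    apply: eq_integral => w _; rewrite expr2 /Z big_distrl /= -sumEFin.
    apply: eq_bigr => b _; rewrite mulr_sumr -sumEFin; apply: eq_bigr => c _.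
    by rewrite -EFinM mulrACA.
  rewrite ge0_integral_sum //; last 2 first.
  - move=> b; apply: emeasurable_sum => c; apply: measurable_funeM.
    by apply/measurable_EFinP; apply: measurable_funM.
  - by move=> b w _; apply: sume_ge0 => c _; rewrite -EFinM lee_fin !mulr_ge0.
  rewrite -sumEFin; apply: eq_bigr => b _; rewrite ge0_integral_sum //; last 2 first.
  - move=> c; apply: measurable_funeM.
    by apply/measurable_EFinP; apply: measurable_funM.
  - by move=> c w _; rewrite -EFinM lee_fin !mulr_ge0.
  rewrite mulr_sumr -sumEFin; apply: eq_bigr => c _.
  rewrite ge0_integralZl_EFin ?mulr_ge0 //; last 2 first.
  - by move=> w _; rewrite lee_fin mulr_ge0.
  - by apply/measurable_EFinP; apply: measurable_funM.
  by rewrite intgg -EFinM mulrA.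
have PT : P setT = 1%E by exact: probability_setT.
have mCE : measurable (~` E) by exact: measurableC.
have key : (\int[P]_w (\1_(~` E) w + 8 * Z w)%:E <= \int[P]_w (4 * Z w ^+ 2 + 4)%:E)%E.
  apply: ge0_le_integral => //.
  - by move=> w _; rewrite lee_fin addr_ge0 // mulr_ge0.
  - apply/measurable_EFinP; apply: measurable_funD; first exact: measurable_indic.
    exact: measurable_funM.
  - apply/measurable_EFinP; apply: measurable_funD => //; apply: measurable_funM => //.
    exact: measurable_funX.
  (* Off E, Z <= 1/2 and 4 Z^2 - 8 Z + 3 = (2 Z - 1) (2 Z - 3) >= 0; on E the difference is 4 (Z -
     1)^2. *)
  move=> w _; rewrite lee_fin indicE; case: (boolP (w \in ~` E)) => [|_].
    rewrite inE => /= nE; have Zh : Z w <= 1 / 2 by rewrite leNgt; apply/negP => /ZE.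
    by rewrite /=; nra.
  by rewrite /=; have := sqr_ge0 (Z w - 1); nra.
have lhsE : (\int[P]_w (\1_(~` E) w + 8 * Z w)%:E = P (~` E) + 8%:E)%E.
  under eq_integral do rewrite EFinD EFinM.
  rewrite ge0_integralD //; first last.
  - by apply: measurable_funeM; exact/measurable_EFinP.
  - by move=> w _; rewrite -EFinM lee_fin mulr_ge0.
  - exact/measurable_EFinP/measurable_indic.
  rewrite integral_indic // setIT ge0_integralZl_EFin // ?intZ ?mule1 //.
  - by move=> w _; rewrite lee_fin.
  - exact/measurable_EFinP.
have rhsE : (\int[P]_w (4 * Z w ^+ 2 + 4)%:E =
    (4 * (\sum_b D b * (\sum_c D c * S b c)) + 4)%:E)%E.
  under eq_integral do rewrite EFinD EFinM.
  rewrite ge0_integralD //; first last.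
  - apply: measurable_funeM; apply/measurable_EFinP; exact: measurable_funX.
  - by move=> w _; rewrite -EFinM lee_fin mulr_ge0 ?sqr_ge0.
  rewrite ge0_integralZl_EFin //; last 2 first.
  - by move=> w _; rewrite lee_fin sqr_ge0.
  - by apply/measurable_EFinP; exact: measurable_funX.
  have i4 : (\int[P]_w (4%:E : \bar R) = 4%:E)%E.
    by rewrite integral_cst // [X in (_ * X)%E]PT mule1.
  by rewrite intZ2 i4.
have PE : (P (~` E) = 1 - P E)%E by exact: probability_setC.
move: key; rewrite lhsE rhsE PE.
rewrite -(fineK (fin_num_measure P E mE)).
by rewrite -EFinB -EFinD !lee_fin; lra.
Qed.

End second_moment.

(** * Products of two Gaussian bumps *)

Section bump_algebra.
Context {R : realType}.
Implicit Types a r x y t : R.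

(* [x^2 + y^2] decouples in terms of [x + y] and [x - y]. *)
Lemma bump_pair t x y : 0 < t ->
  bump t x * bump t y = 2^-1 * (bump (t / 2) ((x + y) / 2) * bump (t / 2) ((x - y) / 2)).
Proof.
move=> t0; rewrite /bump [LHS]mulrACA [in RHS]mulrACA -!expRD -!invfM -!expr2.
rewrite !sqr_sqrtr ?ltW ?divr_gt0 //.
have -> : - (((x + y) / 2) ^+ 2 / (t / 2)) - ((x - y) / 2) ^+ 2 / (t / 2) =
          - (x ^+ 2 / t) - y ^+ 2 / t by field; exact: lt0r_neq0.
rewrite mulrCA; congr (_ * _); field; exact: lt0r_neq0.
Qed.

(** For centered Gaussians of variance a and correlation r, the half sum and half difference are
    independent, with bumps of widths a (1 + r) and a (1 - r). The factor on the right is the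
    likelihood ratio against the uncorrelated pair. *)
Lemma bump_ratio a r x y : 0 < a -> -1 < r < 1 ->
  2^-1 * (bump (a * (1 + r)) ((x + y) / 2) * bump (a * (1 - r)) ((x - y) / 2)) =
  (Num.sqrt (1 - r ^+ 2))^-1 *
    expR ((r * (x * y) - r ^+ 2 * ((x ^+ 2 + y ^+ 2) / 2)) / (a * (1 - r ^+ 2))) *
  (bump (2 * a) x * bump (2 * a) y).
Proof.
move=> a0 /andP[r1 r2].
have r1' : 0 < 1 + r by lra. have r2' : 0 < 1 - r by lra.
have rr : 1 - r ^+ 2 = (1 + r) * (1 - r) by ring.
have a2 : 0 < 2 * a by rewrite mulr_gt0.
set q := Num.sqrt _; set e := expR _.
have q0 : 0 < q by rewrite sqrtr_gt0 rr mulr_gt0.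
have -> : bump (2 * a) x * bump (2 * a) y =
    expR (- (x ^+ 2 / (2 * a)) - y ^+ 2 / (2 * a)) / (2 * a).
  by rewrite /bump mulrACA -expRD -invfM -expr2 sqr_sqrtr // ltW.
have -> : bump (a * (1 + r)) ((x + y) / 2) * bump (a * (1 - r)) ((x - y) / 2) =
    e * expR (- (x ^+ 2 / (2 * a)) - y ^+ 2 / (2 * a)) / (a * q).
  rewrite /bump mulrACA -!expRD -invfM -sqrtrM ?mulr_ge0 ?(ltW a0) ?(ltW r1') //.
  have -> : a * (1 + r) * (a * (1 - r)) = a ^+ 2 * (1 - r ^+ 2) by ring.
  rewrite sqrtrM ?sqr_ge0 // sqrtr_sqr ger0_norm ?(ltW a0) //.
  congr (expR _ / _); rewrite rr; field.
  by rewrite !lt0r_neq0.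
by field; rewrite !lt0r_neq0.
Qed.

End bump_algebra.

(** * First and second moments of the bump of a colouring *)

Section colouring_moments.
Context {R : realType} {disp : measure_display} {T : measurableType disp}.
Variable P : probability T R.
Context {d n : nat}.
Variables (M : 'M[R]_(d, n)) (X : 'I_d * 'I_n -> {RV P >-> R}) (s t : R).
Hypotheses (s_gt0 : 0 < s) (iidX : iid_gaussian s X) (t_gt0 : 0 < t).
Implicit Types b c : {ffun 'I_n -> bool}.

Let sgn b j : R := (-1) ^+ b j.

Definition detpart b (i : 'I_d) : R := (M *m sign_vec b) i 0.

Definition rndpart b (w : T) (i : 'I_d) : R :=
  ((M + random_mx X w) *m sign_vec b) i 0.

Definition vbump b w : R := \prod_i bump t (rndpart b w i).

Definition vbump_mean b : R := \prod_i bump (t + 2 * s ^+ 2 * n%:R) (detpart b i).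

(* In the notation of the header, [halfvar] is a, [agreement] is <x, y>, [corr]
   is r and [detdot] is <M x, M y>. *)
Definition halfvar : R := t / 2 + s ^+ 2 * n%:R.

Definition agreement b c : R := \sum_j (-1) ^+ b j * (-1) ^+ c j.

Definition corr b c : R := s ^+ 2 * agreement b c / halfvar.

Definition detdot b c : R := \sum_i detpart b i * detpart c i.

Definition pair_ratio b c : R :=
  (Num.sqrt (1 - corr b c ^+ 2))^-1 ^+ d *
  expR ((corr b c * detdot b c - corr b c ^+ 2 * ((detdot b b + detdot c c) / 2)) /
        (halfvar * (1 - corr b c ^+ 2))).

Lemma halfvar_gt0 : 0 < halfvar.
Proof. by rewrite ltr_wpDr ?divr_gt0 // mulr_ge0 ?sqr_ge0. Qed.

Lemma agreement_le b c : `|agreement b c| <= n%:R.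
Proof.
apply: le_trans (ler_norm_sum _ _ _) _.
rewrite -[X in _ <= X%:R]card_ord -sumr_const ler_sum // => j _.
by rewrite normrM !normrX !normrN1 !expr1n mul1r.
Qed.

(** Strict because of the term t / 2 in [halfvar]; this keeps the ratio finite even for b = c. *)
Lemma corr_itv b c : -1 < corr b c < 1.
Proof.
rewrite -ltr_norml /corr normrM normfV [`|halfvar|]gtr0_norm ?halfvar_gt0 //.
rewrite ltr_pdivrMr ?halfvar_gt0 // mul1r normrM ger0_norm ?sqr_ge0 //.
apply: (@le_lt_trans _ _ (s ^+ 2 * n%:R)).
  by rewrite ler_wpM2l ?sqr_ge0 ?agreement_le.
by rewrite ltr_pwDl ?divr_gt0.
Qed.

Lemma rndpartE b w i : rndpart b w i = detpart b i + \sum_j sgn b j * X (i, j) w.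
Proof.
rewrite /rndpart mulmxDl mxE; congr (_ + _); rewrite mxE.
by apply: eq_bigr => j _; rewrite !mxE mulrC.
Qed.

Let sgn1 b j : sgn b j = 1 \/ sgn b j = -1.
Proof. by rewrite /sgn; case: (b j); [right|left]. Qed.

Let sum_fiber (Q : pred 'I_n) (F : 'I_d * 'I_n -> R) i :
  \sum_(ij | (ij.1 == i) && Q ij.2) F ij = \sum_(j | Q j) F (i, j).
Proof.
rewrite (eq_bigr (fun ij => F (ij.1, ij.2))) => [|[]//].
rewrite -(pair_big_dep (fun i' => i' == i) (fun _ j => Q j) (fun i' j => F (i', j))) /=.
by rewrite big_pred1_eq.
Qed.

Lemma vbump_gt0 b w : 0 < vbump b w.
Proof. by apply: prodr_gt0 => i _; exact: bump_gt0. Qed.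

Lemma vbump_mean_gt0 b : 0 < vbump_mean b.
Proof.
apply: prodr_gt0 => i _; apply: bump_gt0.
by rewrite ltr_wpDr // mulr_ge0 // mulr_ge0 ?sqr_ge0.
Qed.

Lemma measurable_rndpart b i : measurable_fun setT (fun w => rndpart b w i).
Proof.
under eq_fun do rewrite rndpartE.
apply: measurable_funD => //; apply: measurable_sum => j.
by apply: measurable_funM.
Qed.

Lemma measurable_vbump b : measurable_fun setT (vbump b).
Proof.
apply: measurable_prod => i _.
exact: (measurableT_comp (measurable_bump _) (measurable_rndpart b i)).
Qed.

Lemma integral_vbump b : (\int[P]_w (vbump b w)%:E = (vbump_mean b)%:E)%E.
Proof.
have := @integral_prod_bump _ _ _ P _ _ X s s_gt0 iidX
  (fun ij => ij.1) (fun ij => sgn b ij.2) (detpart b) t (fun ij => sgn1 b ij.2) t_gt0.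
have fib (F : 'I_d * 'I_n -> R) i : \sum_(ij | ij.1 == i) F ij = \sum_j F (i, j).
  by rewrite -(sum_fiber predT); apply: eq_bigl => ij; rewrite andbT.
move=> h; transitivity (\int[P]_w (\prod_k bump t (detpart b k +
    \sum_(i | i.1 == k) sgn b i.2 * X i w))%:E)%E.
  apply: eq_integral => w _; congr EFin; apply: eq_bigr => i _.
  by rewrite rndpartE fib.
rewrite h; congr EFin; apply: eq_bigr => i _.
by rewrite fib sumr_const card_ord.
Qed.

(** In each row, the columns where b and c agree enter only the half sum of the two coordinates, the
    others only the half difference. Hence the groups are indexed by a row and a Boolean. *)
Lemma integral_vbump_pair b c :
  (\int[P]_w (vbump b w * vbump c w)%:E =
   (pair_ratio b c * (vbump_mean b * vbump_mean c))%:E)%E.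
Proof.
pose kap (ij : 'I_d * 'I_n) := (ij.1, b ij.2 == c ij.2).
pose p (k : 'I_d * bool) := if k.2 then (detpart b k.1 + detpart c k.1) / 2
  else (detpart b k.1 - detpart c k.1) / 2.
have t2 : 0 < t / 2 by rewrite divr_gt0.
have := @integral_prod_bump _ _ _ P _ _ X s s_gt0 iidX
  kap (fun ij => sgn b ij.2) p (t / 2) (fun ij => sgn1 b ij.2) t2.
have fib (F : 'I_d * 'I_n -> R) i e :
    \sum_(ij | kap ij == (i, e)) F ij = \sum_(j | (b j == c j) == e) F (i, j).
  by rewrite -(sum_fiber (fun j => (b j == c j) == e)); apply: eq_bigl.
have prodE (G : 'I_d * bool -> R) : \prod_k G k = \prod_i (G (i, true) * G (i, false)).
  rewrite (eq_bigr (fun k => G (k.1, k.2))) => [|[]//].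
  rewrite -(pair_big predT predT (fun i e => G (i, e))) /=.
  by apply: eq_bigr => i _; rewrite big_bool.
move=> h.
pose V w : R := \prod_k bump (t / 2) (p k + \sum_(i | kap i == k) sgn b i.2 * X i w).
transitivity (\int[P]_w ((2^-1 ^+ d)%:E * (V w)%:E))%E.
  apply: eq_integral => w _; rewrite -EFinM; congr EFin.
  rewrite /V prodE -[X in 2^-1 ^+ X]card_ord -prodr_const -!big_split /=.
  apply: eq_bigr => i _; rewrite (bump_pair (rndpart b w i)) //.
  have hA : (rndpart b w i + rndpart c w i) / 2 =
      p (i, true) + \sum_(ij | kap ij == (i, true)) sgn b ij.2 * X ij w.
    rewrite fib /p /= !rndpartE addrACA -big_split mulrDl mulr_suml; congr (_ + _).
    rewrite [RHS]big_mkcond; apply: eq_bigr => j _ /=; rewrite /sgn.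
    by case: (b j); case: (c j) => /=; field.
  have hB : (rndpart b w i - rndpart c w i) / 2 =
      p (i, false) + \sum_(ij | kap ij == (i, false)) sgn b ij.2 * X ij w.
    rewrite fib /p /= !rndpartE opprD addrACA -sumrB mulrDl mulr_suml; congr (_ + _).
    rewrite [RHS]big_mkcond; apply: eq_bigr => j _ /=; rewrite /sgn.
    by case: (b j); case: (c j) => /=; field.
  by rewrite hA hB.
rewrite ge0_integralZl_EFin ?exprn_ge0 ?invr_ge0 //; last 2 first.
- by move=> w _; rewrite lee_fin; apply: prodr_ge0 => k _; exact/ltW/bump_gt0.
- apply/measurable_EFinP; apply: measurable_prod => k _.
  apply: (measurableT_comp (measurable_bump _)); apply: measurable_funD => //.
  under eq_fun do rewrite big_mkcond.
  apply: measurable_sum => ij /=; case: (kap ij == k) => //.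
  exact: measurable_funM.
rewrite /V h -EFinM; congr EFin.
have h0 := halfvar_gt0.
have cE : s ^+ 2 * agreement b c = halfvar * corr b c.
  by rewrite /corr; field; exact: lt0r_neq0.
have nE : n%:R = \sum_(j < n) (1 : R) by rewrite sumr_const card_ord.
(* The number of agreeing columns is (n + <x, y>) / 2. *)
have v1 : t / 2 + 2 * s ^+ 2 * \sum_(j | (b j == c j) == true) 1 = halfvar * (1 + corr b c).
  rewrite mulrDr mulr1 -cE /halfvar -addrA -mulrDr -mulrA mulrCA; congr (_ + _ * _).
  rewrite /agreement nE -big_split big_mkcond mulr_sumr.
  by apply: eq_bigr => j _ /=; case: (b j); case: (c j) => /=; ring.
have v2 : t / 2 + 2 * s ^+ 2 * \sum_(j | (b j == c j) == false) 1 = halfvar * (1 - corr b c).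
  rewrite mulrBr mulr1 -cE /halfvar -addrA -mulrBr -mulrA mulrCA; congr (_ + _ * _).
  rewrite /agreement nE -sumrB big_mkcond mulr_sumr.
  by apply: eq_bigr => j _ /=; case: (b j); case: (c j) => /=; ring.
rewrite prodE -[X in 2^-1 ^+ X]card_ord -prodr_const -big_split /=.
have tE : 2 * halfvar = t + 2 * s ^+ 2 * n%:R by rewrite /halfvar; field.
under eq_bigr do rewrite !fib v1 v2 /p /= bump_ratio ?halfvar_gt0 ?corr_itv // tE.
rewrite big_split /= [X in X * _]big_split [X in _ * X]big_split /= prodr_const card_ord.
rewrite /pair_ratio; congr (_ * _ * _).
rewrite -expR_sum; congr expR; rewrite -mulr_suml; congr (_ / _).
rewrite sumrB -!mulr_sumr -mulr_suml -big_split /= /detdot.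
by congr (_ - _ * ((\sum_i _) / 2)).
Qed.

End colouring_moments.

(** * Random colourings of a Komlos instance *)

Section komlos_colouring.
Context {R : realType} {d n : nat}.
Variable M : 'M[R]_(d, n).

Lemma dotv_row_mx m1 m2 (x1 y1 : 'rV[R]_m1) (x2 y2 : 'rV[R]_m2) :
  dotv (row_mx x1 x2) (row_mx y1 y2) = dotv x1 y1 + dotv x2 y2.
Proof.
rewrite /dotv big_split_ord /=; congr (_ + _); apply: eq_bigr => i _.
  by rewrite !row_mxEl.
by rewrite !row_mxEr.
Qed.

(* The walk is run on the columns of [M] stacked over the identity, so that the
   signed sum [M x] and the sign vector [x] are jointly subgaussian. *)
Lemma komlos_signs : komlos M ->
  exists2 D : {ffun 'I_n -> bool} -> R, prob_weight D &
  forall (U : 'I_d -> R) (V : 'I_n -> R),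
    \sum_b D b * expR (\sum_i detpart M b i * U i + \sum_j (-1) ^+ b j * V j) <=
    expR (8 * (\sum_i U i ^+ 2 + \sum_j V j ^+ 2)).
Proof.
move=> kM; pose q : R := Num.sqrt 2.
have q0 : 0 < q by rewrite sqrtr_gt0.
have q2 : q * q = 2 by rewrite -expr2 sqr_sqrtr.
(* A stacked column has squared norm at most 2, so it is divided by sqrt 2; this doubles the
   constant 4 of the walk to 8. *)
pose w j : 'rV[R]_(d + n) := q^-1 *: row_mx (\row_i M i j) (\row_k (k == j)%:R).
have w1 j : dotv (w j) (w j) <= 1.
  rewrite dotvZl dotvZr mulrA -invfM q2 dotv_row_mx.
  have h1 : dotv (\row_i M i j) (\row_i M i j) <= 1.
    have -> : dotv (\row_i M i j) (\row_i M i j) = \sum_i M i j ^+ 2.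
      by apply: eq_bigr => i _; rewrite mxE expr2.
    have S0 : 0 <= \sum_i M i j ^+ 2 by apply: sumr_ge0 => i _; exact: sqr_ge0.
    by rewrite -(sqr_sqrtr S0) expr_le1 ?sqrtr_ge0 // kM.
  have h2 : dotv (\row_k (k == j)%:R) (\row_k (k == j)%:R) = 1 :> R.
    rewrite /dotv (bigD1 j) //= !mxE eqxx mulr1 big1 ?addr0 // => k /negbTE kj.
    by rewrite !mxE kj mulr0.
  by rewrite h2; lra.
have [D hD hDv] := subgaussian_signs w1; exists D => // U V.
pose v := q *: row_mx (\row_i U i) (\row_j V j).
have vv : 4 * dotv v v = 8 * (\sum_i U i ^+ 2 + \sum_j V j ^+ 2).
  rewrite /v dotvZl dotvZr [q * (q * _)]mulrA q2 dotv_row_mx mulrA (_ : 4 * 2 = 8); last by ring.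
  by congr (_ * (_ + _)); apply: eq_bigr => i _; rewrite mxE expr2.
have := hDv v; rewrite vv.
apply: le_trans; apply: ler_sum => b _; rewrite ler_wpM2l ?(hD.1) // ler_expR.
rewrite le_eqVlt; apply/orP; left; apply/eqP.
rewrite /v dotvZr /comb dotv_suml.
under [in RHS]eq_bigr do rewrite dotvZl dotvZl dotv_row_mx mulrCA.
rewrite -mulr_sumr mulrA divff ?lt0r_neq0 // mul1r.
under [in RHS]eq_bigr do rewrite mulrDr.
rewrite big_split /=; congr (_ + _).
  under [in RHS]eq_bigr do rewrite /dotv mulr_sumr.
  rewrite exchange_big /=; apply: eq_bigr => i _.
  rewrite /detpart [(M *m _) i 0]mxE mulr_suml; apply: eq_bigr => j _; rewrite !mxE; ring.
apply: eq_bigr => j _; rewrite /dotv (bigD1 j) //= !mxE eqxx mul1r big1 ?addr0 //.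
by move=> k /negbTE kj; rewrite !mxE kj mul0r.
Qed.

(* Conditioning on [|M x|^2 <= 64 d], an event of probability at least [1/2],
   at most doubles exponential moments. *)
Lemma good_signs : (0 < d)%N -> (0 < n)%N -> komlos M ->
  exists2 D : {ffun 'I_n -> bool} -> R, prob_weight D &
  [/\ forall b, D b != 0 -> detdot M b b <= 64 * d%:R,
      forall c, \sum_b D b * expR (agreement b c ^+ 2 / (64 * n%:R)) <= 3 &
      forall c, detdot M c c <= 64 * d%:R ->
        \sum_b D b * expR (detdot M b c ^+ 2 / (4096 * d%:R)) <= 3].
Proof.
move=> d0 n0 kM; have [D [D0 D1] hD] := komlos_signs kM.
have n0' : 0 < n%:R :> R by rewrite ltr0n.
have d0' : 0 < d%:R :> R by rewrite ltr0n.
have s32 : Num.sqrt 2 <= 3 / 2 :> R.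
  have h : (3 / 2 : R) = Num.sqrt ((3 / 2) ^+ 2) by rewrite sqrtr_sqr ger0_norm.
  by rewrite h ler_wsqrtr //; lra.
have hagr c : \sum_b D b * expR (agreement b c ^+ 2 / (64 * n%:R)) <= 3 / 2.
  have := @subgaussian_sqr R _ D (fun b => agreement b c) 1 (8 * n%:R) D0 ler01
    ltac:(by rewrite mulr_gt0).
  rewrite mulrA (_ : 8 * 8 = 64); last by ring.
  move=> h; apply: le_trans (h _) _; last by rewrite mul1r.
  move=> t; have sE : \sum_j (t * (-1) ^+ c j) ^+ 2 = t ^+ 2 * n%:R.
    rewrite mulr_natr -[n in RHS]card_ord -sumr_const; apply: eq_bigr => j _.
    by rewrite exprMn -exprM mulnC exprM sqrrN expr1n expr1n mulr1.
  have := hD (fun=> 0) (fun j => t * (-1) ^+ c j).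
  rewrite mul1r; under eq_bigr => b _.
    rewrite big1 => [|i _]; last by rewrite mulr0.
    under eq_bigr do rewrite mulrCA.
    rewrite add0r -mulr_sumr; over.
  rewrite [X in 8 * (X + _)]big1 => [|i _]; last by rewrite expr2 mul0r.
  by rewrite add0r sE (_ : 8 * (t ^+ 2 * n%:R) = 8 * n%:R * t ^+ 2) //; ring.
have hU (U : 'I_d -> R) (v : R) : 0 < v -> 8 * \sum_i U i ^+ 2 <= v ->
    \sum_b D b * expR ((\sum_i detpart M b i * U i) ^+ 2 / (8 * v)) <= 3 / 2.
  move=> v0 Uv; apply: le_trans (@subgaussian_sqr R _ D _ 1 v D0 ler01 v0 _) _;
    last by rewrite mul1r.
  move=> t; have := hD (fun i => t * U i) (fun=> 0).
  rewrite mul1r; under eq_bigr => b _.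
    rewrite [X in _ + X]big1 => [|i _]; last by rewrite mulr0.
    under eq_bigr do rewrite mulrCA.
    rewrite addr0 -mulr_sumr; over.
  move/le_trans; apply; rewrite ler_expR [X in 8 * (_ + X)]big1 => [|i _];
    last by rewrite expr2 mul0r.
  under eq_bigr do rewrite exprMn.
  by rewrite addr0 -mulr_sumr mulrCA mulrC ler_wpM2r ?sqr_ge0.
(* From exp y >= 1 + y with y the square over 64: the mean of y is at most 3/2 - 1. *)
have hx i : \sum_b D b * detpart M b i ^+ 2 <= 32.
  have := hU (fun k => (k == i)%:R) 8 ltac:(by []).
  rewrite (bigD1 i) //= eqxx expr1n big1 ?addr0 ?mulr1 => [/(_ (lexx _))|k /negbTE ->];
    last by rewrite expr2 mul0r.
  under eq_bigr => b _.
    rewrite (bigD1 i) //= eqxx mulr1 big1 ?addr0 => [|k /negbTE ->]; last by rewrite mulr0.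
    over.
  move=> h; have h' : \sum_b D b * (1 + detpart M b i ^+ 2 / (8 * 8)) <= 3 / 2.
    by apply: le_trans h; apply: ler_sum => b _; rewrite ler_wpM2l // expR_ge1Dx.
  have e : \sum_b D b * (1 + detpart M b i ^+ 2 / (8 * 8)) =
      1 + (\sum_b D b * detpart M b i ^+ 2) / (8 * 8).
    rewrite mulr_suml -[X in _ = X + _]D1 -big_split.
    by apply: eq_bigr => b _ /=; ring.
  by rewrite e in h'; lra.
have hnorm : \sum_b D b * detdot M b b <= 32 * d%:R.
  under eq_bigr do rewrite /detdot mulr_sumr.
  rewrite exchange_big /= mulr_natr -[d in leRHS]card_ord -sumr_const.
  by apply: ler_sum => i _; under eq_bigr do rewrite -expr2.
pose good b := detdot M b b <= 64 * d%:R.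
pose m := \sum_(b | good b) D b.
have dd0 b : 0 <= detdot M b b by apply: sumr_ge0 => i _; rewrite -expr2 sqr_ge0.
(* Markov's inequality: the mean of |M x|^2 is at most half the threshold 64 d. *)
have mh : 1 / 2 <= m.
  have e1 : m + \sum_(b | ~~ good b) D b = 1 by rewrite -D1 [RHS](bigID good).
  have e2 : 64 * d%:R * \sum_(b | ~~ good b) D b <= 32 * d%:R.
    apply: le_trans hnorm; rewrite [leRHS](bigID good) /= mulr_sumr.
    rewrite ler_wpDl //; first by apply: sumr_ge0 => b _; rewrite mulr_ge0.
    by apply: ler_sum => b; rewrite -ltNge => /ltW h; rewrite mulrC ler_wpM2l.
  have e3 : \sum_(b | ~~ good b) D b <= 1 / 2.
    by rewrite -(ler_pM2l (_ : 0 < 64 * d%:R)) ?mulr_gt0 //; lra.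
  by lra.
have m0 : 0 < m by lra.
pose D' b := if good b then D b / m else 0.
have D'le b : D' b <= 2 * D b.
  rewrite /D'; case: ifP => _; last by rewrite mulr_ge0.
  rewrite mulrC ler_wpM2r // -(ler_pM2r m0) mulVf ?lt0r_neq0 //; lra.
have D'sum (F : {ffun 'I_n -> bool} -> R) : (forall b, 0 <= F b) -> \sum_b D b * F b <= 3 / 2 ->
    \sum_b D' b * F b <= 3.
  move=> F0 h; apply: (@le_trans _ _ (2 * \sum_b D b * F b)); last by lra.
  by rewrite mulr_sumr; apply: ler_sum => b _; rewrite mulrA ler_wpM2r.
exists D'.
  split=> [b|]; first by rewrite /D'; case: ifP => // _; rewrite divr_ge0 // ltW.
  by rewrite /D' -big_mkcond /= -mulr_suml divff // lt0r_neq0.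
split=> [b|c|c cg].
- by rewrite /D'; case: ifP => //; rewrite eqxx.
- by apply: D'sum => // b; exact: expR_ge0.
- apply: D'sum => [b|]; first exact: expR_ge0.
  (* 512 is 8 times the threshold 64, and 4096 is 8 times 512. *)
  have := hU (detpart M c) (512 * d%:R) ltac:(by rewrite mulr_gt0).
  rewrite mulrA (_ : 8 * 512 = 4096); last by ring.
  apply; have -> : \sum_i detpart M c i ^+ 2 = detdot M c c by apply: eq_bigr => i _; rewrite expr2.
  by lra.
Qed.

End komlos_colouring.

(** * The event of small discrepancy and its measurability *)

Section discrepancy_event.
Context {R : realType}.

Lemma mx_norm_le d (z : 'cV[R]_d) (theta : R) : 0 <= theta ->
  (`|z| <= theta) <-> (forall i, `|z i 0| <= theta).
Proof.
move=> th0; rewrite -[`|z|]/(mx_norm z); split => [h i|h].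
  apply: le_trans h; rewrite mx_normrE.
  exact: (le_bigmax _ (fun ij => `|z ij.1 ij.2|) (i, 0)).
have [->//|/mx_norm_neq0[[i j] ->]] := eqVneq (mx_norm z) 0.
by rewrite /= ord1.
Qed.

Lemma disc_le d n (A : 'M[R]_(d, n)) (theta : R) : 0 <= theta ->
  (disc A <= theta) <-> exists b, forall i, `|(A *m sign_vec b) i 0| <= theta.
Proof.
move=> th0; rewrite /disc; split => [|[b /(mx_norm_le _ th0) hb]]; last first.
  exact: le_trans (bigmin_le _ b _) hb.
move=> h; apply: contrapT => nex; move: h; apply/negP; rewrite -ltNge.
have nb b : theta < `|A *m sign_vec b|.
  by rewrite ltNge; apply/negP => /(mx_norm_le _ th0) hb; apply: nex; exists b.
by apply/bigmin_gtP; split=> [|b _]; exact: nb.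
Qed.

Lemma measurable_disc_le {disp : measure_display} {T : measurableType disp}
    (P : probability T R) d n (M : 'M[R]_(d, n))
    (X : 'I_d * 'I_n -> {RV P >-> R}) (theta : R) : 0 <= theta ->
  measurable [set w | disc (M + random_mx X w) <= theta].
Proof.
move=> th0.
have -> : [set w | disc (M + random_mx X w) <= theta] =
    \bigcup_(b in [set: {ffun 'I_n -> bool}]) \bigcap_(i in [set: 'I_d])
      [set w | `|rndpart M X b w i| <= theta].
  apply/seteqP; split => w /=.
    by move=> /(disc_le _ th0)[b hb]; exists b => // i _; exact: hb.
  by move=> [b _ hb]; apply/(disc_le _ th0); exists b => i; exact: hb.
apply: fin_bigcup_measurable; first exact: finite_finset.
move=> b _; apply: fin_bigcap_measurable; first exact: finite_finset.
move=> i _; rewrite -[X in measurable X]setTI.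
apply: measurable_fun_le => //.
apply: (measurableT_comp (@normr_measurable R setT)).
exact: measurable_rndpart.
Qed.

End discrepancy_event.

(** * Deterministic bounds on the pair ratio *)

Section ratio_bound.
Context {R : realType}.

Lemma quadratic_form_le (k al be p q : R) : 0 < al -> 0 < be -> k ^+ 2 <= 4 * (al * be) ->
  k * (p * q) <= al * p ^+ 2 + be * q ^+ 2.
Proof.
move=> al0 be0 hk; rewrite -subr_ge0 -(pmulr_rge0 _ (_ : 0 < 4 * al)) ?mulr_gt0 //.
have -> : 4 * al * (al * p ^+ 2 + be * q ^+ 2 - k * (p * q)) =
  (2 * al * p - k * q) ^+ 2 + (4 * (al * be) - k ^+ 2) * q ^+ 2 by ring.
by rewrite addr_ge0 ?sqr_ge0 // mulr_ge0 ?sqr_ge0 // subr_ge0.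
Qed.

Lemma scaled_amgm (L a p q n d e f : R) : 0 < a -> 0 < n -> 0 < d -> 0 < e -> 0 < f ->
  (4 / 3 * L) ^+ 2 * (e * f * d) <= 4 * (n * a ^+ 2) ->
  L * (4 / 3 / a * (p * q)) <= n / e * p ^+ 2 + (f * d)^-1 * q ^+ 2.
Proof.
move=> a0 n0 d0 e0 f0 h.
have -> : L * (4 / 3 / a * (p * q)) = 4 / 3 * (L / a) * (p * q).
  by field; exact: lt0r_neq0.
apply: quadratic_form_le; rewrite ?divr_gt0 ?invr_gt0 ?mulr_gt0 //.
have -> : 4 * (n / e * (f * d)^-1) = 4 * (n * a ^+ 2) / (e * f * d * a ^+ 2).
  by field; rewrite !lt0r_neq0.
rewrite ler_pdivlMr ?mulr_gt0 ?exprn_gt0 //; apply: le_trans h.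
rewrite le_eqVlt; apply/orP; left; apply/eqP; field; exact: lt0r_neq0.
Qed.

(** Via exp W <= 1 + W exp W and L W exp W <= exp (2 L W). If exp Q has a bounded mean, exp W has
    mean 1 + O(1 / L), which is what the second moment method needs. *)
Lemma expR_le_interp (L W Q : R) : 1 <= L -> 0 <= W -> 2 * (L * W) <= Q ->
  expR W <= 1 + L^-1 * expR Q.
Proof.
move=> L1 W0 hQ; have L0 : 0 < L by lra.
have e1 : expR W <= 1 + W * expR W.
  have := expR_ge1Dx (- W); rewrite expRN => h.
  have := ler_wpM2r (expR_ge0 W) h; rewrite mulVf ?lt0r_neq0 ?expR_gt0 //.
  by rewrite mulrDl mul1r mulNr; lra.
apply: le_trans e1 _; rewrite lerD2l -ler_pdivrMl ?invr_gt0 // invrK mulrA.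
apply: (@le_trans _ _ (expR (L * W) * expR (L * W))).
  apply: ler_pM; rewrite ?expR_ge0 ?mulr_ge0 ?(ltW L0) //.
    by have := expR_ge1Dx (L * W); lra.
  by rewrite ler_expR ler_peMl.
by rewrite -expRD ler_expR; lra.
Qed.

Lemma expR_mean_le (A B : R) : expR ((A + B) / 2) <= expR A + expR B.
Proof.
have [AB|AB] := leP A B.
  by rewrite (@le_trans _ _ (expR B)) ?ler_expR ?lerDr ?expR_ge0 //; lra.
by rewrite (@le_trans _ _ (expR A)) ?ler_expR ?lerDl ?expR_ge0 //; lra.
Qed.

(** Here c, S and m stand for <x, y>, <M x, M y> and the mean of |M x|^2 and |M y|^2. For |r| <= 1/2
    the factor 1 / (1 - r^2) is at most 4/3, the prefactor is at most exp (d r^2), and the negative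
    term in m is dropped. *)
Lemma ratio_small (d n : nat) (a L r c S m : R) : (0 < d)%N -> (0 < n)%N ->
  0 < a -> 1 <= L -> `|r| * n%:R <= `|c| -> 0 <= m -> `|r| <= 1 / 2 ->
  512 * L * d%:R <= n%:R -> (2000 * L) ^+ 2 * d%:R <= n%:R * a ^+ 2 ->
  (Num.sqrt (1 - r ^+ 2))^-1 ^+ d *
    expR ((r * S - r ^+ 2 * m) / (a * (1 - r ^+ 2))) <=
  1 + L^-1 * (expR (c ^+ 2 / (64 * n%:R)) + expR (S ^+ 2 / (4096 * d%:R))).
Proof.
rewrite -(ltr0n R) -[(0 < n)%N](ltr0n R) => d0 n0 a0 L1 rc m0 rh h1 h2.
have L0 : 0 < L by lra.
have r0 := normr_ge0 r; have S0 := normr_ge0 S.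
have rr : r ^+ 2 = `|r| ^+ 2 by rewrite real_normK ?num_real.
have r4 : 0 <= r ^+ 2 <= 1 / 4 by rewrite rr; apply/andP; split; nra.
have cr : r ^+ 2 * n%:R ^+ 2 <= c ^+ 2.
  by rewrite -[c ^+ 2]real_normK ?num_real // rr -exprMn ler_sqr ?nnegrE ?mulr_ge0 // ltW.
have pre : (Num.sqrt (1 - r ^+ 2))^-1 ^+ d <= expR (d%:R * r ^+ 2).
  rewrite expRM_natl; apply: lerXn2r; rewrite ?nnegrE ?invr_ge0 ?sqrtr_ge0 ?expR_ge0 //.
  have h := inv_onem_le_expR r4.
  rewrite -(@ler_sqr R) ?nnegrE ?invr_ge0 ?sqrtr_ge0 ?expR_ge0 //.
  rewrite exprVn sqr_sqrtr; last lra.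
  by rewrite -expRM_natl.
pose W := d%:R * r ^+ 2 + 4 / 3 / a * (`|r| * `|S|).
have expo : (r * S - r ^+ 2 * m) / (a * (1 - r ^+ 2)) <= 4 / 3 / a * (`|r| * `|S|).
  rewrite ler_pdivrMr; last by rewrite mulr_gt0 //; lra.
  have -> : 4 / 3 / a * (`|r| * `|S|) * (a * (1 - r ^+ 2)) =
      4 / 3 * (1 - r ^+ 2) * (`|r| * `|S|) by field; exact: lt0r_neq0.
  have k1 : r * S <= `|r| * `|S| by rewrite -normrM ler_norm.
  have k2 : 0 <= `|r| * `|S| by rewrite mulr_ge0.
  have k3 : 0 <= r ^+ 2 * m by rewrite mulr_ge0 ?sqr_ge0.
  have k4 : 1 <= 4 / 3 * (1 - r ^+ 2) by lra.
  have := ler_wpM2r k2 k4; lra.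
have W0 : 0 <= W.
  apply: addr_ge0; first by rewrite mulr_ge0 ?sqr_ge0 // ltW.
  by apply: mulr_ge0; [rewrite divr_ge0 // ltW|exact: mulr_ge0].
set A := c ^+ 2 / _; set B := S ^+ 2 / _.
have WQ : 2 * (L * W) <= (A + B) / 2.
  have f1 : r ^+ 2 * n%:R / 64 <= A.
    rewrite /A ler_pdivlMr ?mulr_gt0 //.
    by have -> : r ^+ 2 * n%:R / 64 * (64 * n%:R) = r ^+ 2 * n%:R ^+ 2 by field.
  have f2 : L * (d%:R * r ^+ 2) <= A / 8.
    have : 512 * L * d%:R * r ^+ 2 <= n%:R * r ^+ 2 by rewrite ler_wpM2r ?sqr_ge0.
    lra.
  (* Origin of 2000: the weighted mean inequality needs (4/3)^2 * 512 * 4096 <= 2000^2. *)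
  have f3 : L * (4 / 3 / a * (`|r| * `|S|)) <= A / 8 + B / 4.
    have p1 : (0 : R) < 512 by rewrite ltr0n.
    have p2 : (0 : R) < 4 * 4096 by rewrite -natrM ltr0n.
    apply: le_trans (@scaled_amgm L a `|r| `|S| n%:R d%:R _ _ a0 n0 d0 p1 p2 _) _.
      have k : 0 <= L ^+ 2 * d%:R by rewrite mulr_ge0 ?sqr_ge0 // ltW.
      by move: h2; rewrite !exprMn; lra.
    rewrite -rr real_normK ?num_real //.
    have -> : (4 * 4096 * d%:R)^-1 * S ^+ 2 = B / 4 by rewrite /B; field; exact: lt0r_neq0.
    lra.
  rewrite /W mulrDr; lra.
apply: (@le_trans _ _ (expR W)).
  by rewrite /W expRD; apply: ler_pM; rewrite ?expR_ge0 ?exprn_ge0 ?invr_ge0 ?sqrtr_ge0 ?ler_expR.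
apply: le_trans (expR_le_interp L1 W0 WQ) _.
by rewrite lerD2l ler_wpM2l ?invr_ge0 ?(ltW L0) // expR_mean_le.
Qed.

(** For |r| > 1/2, |c| >= n / 2 makes the exponent on the right at least n / 256: half of it pays
    for the worst ratio, the other half for the factor L <= n / 512. *)
Lemma ratio_large (d n : nat) (a t L r c S m : R) : (0 < d)%N -> (0 < n)%N ->
  0 < a -> 0 < t -> 1 <= L -> `|r| * n%:R <= `|c| ->
  t / 2 / a <= 1 - `|r| -> `|S| <= m -> m <= 64 * d%:R -> 1 / 2 < `|r| ->
  512 * L * d%:R <= n%:R ->
  Num.sqrt (2 * a / t) ^+ d * expR (64 * d%:R / a) <= expR (n%:R / 512) ->
  (Num.sqrt (1 - r ^+ 2))^-1 ^+ d *
    expR ((r * S - r ^+ 2 * m) / (a * (1 - r ^+ 2))) <=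
  L^-1 * expR (c ^+ 2 / (64 * n%:R)).
Proof.
move=> d1; move: (d1); rewrite -(ltr0n R) -[(0 < n)%N](ltr0n R).
move=> d0 n0 a0 t0 L1 rc tr Sm md rh h1 h2.
have L0 : 0 < L by lra.
have r0 := normr_ge0 r; have S0 := normr_ge0 S.
have rr : r ^+ 2 = `|r| ^+ 2 by rewrite real_normK ?num_real.
have ta : 0 < t / 2 / a by rewrite !divr_gt0.
have r1 : `|r| < 1 by lra.
have r2 : t / 2 / a <= 1 - r ^+ 2.
  apply: le_trans tr _; rewrite rr; nra.
have pre : (Num.sqrt (1 - r ^+ 2))^-1 ^+ d <= Num.sqrt (2 * a / t) ^+ d.
  apply: lerXn2r; rewrite ?nnegrE ?invr_ge0 ?sqrtr_ge0 //.
  have -> : 2 * a / t = (t / 2 / a)^-1 by field; rewrite !lt0r_neq0.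
  by rewrite sqrtrV ?(ltW ta) // lef_pV2 ?posrE ?sqrtr_gt0 ?ler_wsqrtr //; lra.
(* The negative term is essential here: |r| m - r^2 m <= (1 - r^2) m cancels a denominator that may
   be tiny. *)
have expo : (r * S - r ^+ 2 * m) / (a * (1 - r ^+ 2)) <= 64 * d%:R / a.
  rewrite ler_pdivrMr; last by rewrite mulr_gt0 //; lra.
  have -> : 64 * d%:R / a * (a * (1 - r ^+ 2)) = 64 * d%:R * (1 - r ^+ 2).
    by field; exact: lt0r_neq0.
  have k1 : r * S <= `|r| * m.
    by apply: le_trans (ler_norm _) _; rewrite normrM ler_wpM2l.
  have m0 : 0 <= m by exact: le_trans Sm.
  have k2 : m * (1 - r ^+ 2) <= 64 * d%:R * (1 - r ^+ 2) by rewrite ler_wpM2r //; lra.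
  nra.
apply: (@le_trans _ _ (expR (n%:R / 512))).
  apply: le_trans h2; apply: ler_pM; rewrite ?expR_ge0 ?exprn_ge0 ?invr_ge0 ?sqrtr_ge0 ?ler_expR //.
have cA : n%:R / 256 <= c ^+ 2 / (64 * n%:R).
  rewrite ler_pdivlMr ?mulr_gt0 // -[c ^+ 2]real_normK ?num_real //.
  have hc : n%:R / 2 <= `|c| by nra.
  have : (n%:R / 2) ^+ 2 <= `|c| ^+ 2 by rewrite ler_sqr ?nnegrE ?divr_ge0 // ltW.
  by move=> k; apply: le_trans k; rewrite le_eqVlt; apply/orP; left; apply/eqP; field.
have nL : L <= n%:R / 512.
  have : 1 <= d%:R :> R by rewrite ler1n.
  by nra.
rewrite -ler_pdivrMl ?invr_gt0 // invrK.
apply: (@le_trans _ _ (expR (n%:R / 512) * expR (n%:R / 512))).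
  by rewrite ler_wpM2r ?expR_ge0 //; have := expR_ge1Dx (n%:R / 512 : R); lra.
by rewrite -expRD ler_expR; lra.
Qed.

Lemma ratio_bound (d n : nat) (a t L r c S m : R) : (0 < d)%N -> (0 < n)%N ->
  0 < a -> 0 < t -> 1 <= L -> `|r| * n%:R <= `|c| ->
  t / 2 / a <= 1 - `|r| -> `|S| <= m -> m <= 64 * d%:R ->
  512 * L * d%:R <= n%:R -> (2000 * L) ^+ 2 * d%:R <= n%:R * a ^+ 2 ->
  Num.sqrt (2 * a / t) ^+ d * expR (64 * d%:R / a) <= expR (n%:R / 512) ->
  (Num.sqrt (1 - r ^+ 2))^-1 ^+ d *
    expR ((r * S - r ^+ 2 * m) / (a * (1 - r ^+ 2))) <=
  1 + L^-1 * (expR (c ^+ 2 / (64 * n%:R)) + expR (S ^+ 2 / (4096 * d%:R))).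
Proof.
move=> d0 n0 a0 t0 L1 rc tr Sm md h1 h2 h3.
have [rh|rh] := leP `|r| (1 / 2).
  by apply: ratio_small => //; exact: le_trans Sm.
apply: le_trans (ratio_large d0 n0 a0 t0 L1 rc tr Sm md rh h1 h3) _.
have L0 : 0 < L^-1 by rewrite invr_gt0; lra.
rewrite mulrDr addrCA lerDl; apply: addr_ge0; first exact: ler01.
by apply: mulr_ge0; [exact: ltW|exact: expR_ge0].
Qed.

End ratio_bound.

(** * Probability of small discrepancy at fixed parameters *)

Section smoothed_discrepancy.
Context {R : realType} {disp : measure_display} {T : measurableType disp}.
Variable P : probability T R.
Context {d n : nat}.
Variables (M : 'M[R]_(d, n)) (X : 'I_d * 'I_n -> {RV P >-> R}) (s t L : R).
Hypotheses (d_gt0 : (0 < d)%N) (n_gt0 : (0 < n)%N) (s_gt0 : 0 < s) (t_gt0 : 0 < t).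
Hypotheses (iidX : iid_gaussian s X) (L_ge1 : 1 <= L).

Local Notation a := (@halfvar R n s t).

Hypotheses (Ld : 512 * L * d%:R <= n%:R)
  (La : (2000 * L) ^+ 2 * d%:R <= n%:R * a ^+ 2)
  (aB : Num.sqrt (2 * a / t) ^+ d * expR (64 * d%:R / a) <= expR (n%:R / 512)).

Let a_gt0 : 0 < a.
Proof. exact: halfvar_gt0. Qed.

Let sn_le : s ^+ 2 * n%:R <= a.
Proof. by rewrite /halfvar lerDr divr_ge0 // ltW. Qed.

Lemma prod_bump v (x : 'I_d -> R) :
  \prod_i bump v (x i) = expR (- ((\sum_i x i ^+ 2) / v)) * (Num.sqrt v)^-1 ^+ d.
Proof.
rewrite /bump big_split /= -expR_sum sumrN -mulr_suml; congr (_ * _).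
by rewrite prodr_const card_ord.
Qed.

Lemma normr_detdot_le b c :
  `|detdot M b c| <= (detdot M b b + detdot M c c) / 2.
Proof.
apply: le_trans (ler_norm_sum _ _ _) _.
rewrite /detdot -big_split mulr_suml; apply: ler_sum => i _ /=.
have := sqr_ge0 (detpart M b i - detpart M c i).
have := sqr_ge0 (detpart M b i + detpart M c i).
by move=> h1 h2; rewrite ler_norml; apply/andP; split; lra.
Qed.

Lemma pair_ratio_le b c : detdot M b b <= 64 * d%:R -> detdot M c c <= 64 * d%:R ->
  pair_ratio M s t b c <= 1 + L^-1 * (expR (agreement b c ^+ 2 / (64 * n%:R)) +
    expR (detdot M b c ^+ 2 / (4096 * d%:R))).
Proof.
move=> hb hc.
have rE : `|corr s t b c| = s ^+ 2 * `|@agreement R _ b c| / a.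
  rewrite /corr normrM normfV normrM [`|a|]gtr0_norm // [`|s ^+ 2|]ger0_norm //.
  exact: sqr_ge0.
apply: ratio_bound t_gt0 L_ge1 _ _ _ _ Ld La aB => //.
- rewrite rE mulrAC ler_pdivrMr // mulrAC mulrC ler_wpM2l //.
- rewrite rE lerBrDr -mulrDl ler_pdivrMr // mul1r /halfvar lerD2l.
  by rewrite ler_wpM2l ?sqr_ge0 ?agreement_le.
- exact: normr_detdot_le.
- by lra.
Qed.

(** By [aB] the normalized bump is at most exp (n / 512 - |z|^2 / t). If it exceeds 1/2 >= exp (-1),
    then |z|^2 <= t (1 + n / 512). *)
Lemma rndpart_le b w (theta : R) : detdot M b b <= 64 * d%:R -> 0 <= theta ->
  t * (1 + n%:R / 512) <= theta ^+ 2 ->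
  1 / 2 < vbump M X t b w / vbump_mean M s t b ->
  forall i, `|rndpart M X b w i| <= theta.
Proof.
move=> hb th0 hth h i.
have aE : t + 2 * s ^+ 2 * n%:R = 2 * a by rewrite /halfvar; field.
have a20 : 0 < 2 * a by rewrite mulr_gt0.
set z := rndpart M X b w in h *.
have tq : 0 < Num.sqrt t by rewrite sqrtr_gt0.
have aq : 0 < Num.sqrt (2 * a) by rewrite sqrtr_gt0.
have sq : Num.sqrt (2 * a / t) = Num.sqrt (2 * a) / Num.sqrt t.
  by rewrite sqrtrM ?(ltW a20) // sqrtrV // ltW.
have e1 : vbump M X t b w / vbump_mean M s t b =
    Num.sqrt (2 * a / t) ^+ d * expR (detdot M b b / (2 * a)) *
      expR (- ((\sum_i z i ^+ 2) / t)).
  rewrite /vbump /vbump_mean !prod_bump aE sq.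
  have -> : \sum_i detpart M b i ^+ 2 = detdot M b b.
    by apply: eq_bigr => j _; rewrite expr2.
  rewrite invfM -expRN opprK exprMn !exprVn invrK; ring.
have e2 : expR (detdot M b b / (2 * a)) <= expR (64 * d%:R / a).
  rewrite ler_expR invfM mulrA ler_wpM2r ?invr_ge0 ?(ltW a_gt0) //.
  have : 0 <= d%:R :> R by exact: ler0n.
  lra.
have e3 : 1 / 2 < expR (n%:R / 512) * expR (- ((\sum_i z i ^+ 2) / t)).
  apply: lt_le_trans h _; rewrite e1 ler_wpM2r ?expR_ge0 //.
  by apply: le_trans aB; rewrite ler_wpM2l // exprn_ge0 ?sqrtr_ge0.
have e4 : (\sum_i z i ^+ 2) / t <= 1 + n%:R / 512.
  rewrite -ler_expR expRD; have k : (2 : R) <= expR 1 by have := expR_ge1Dx (1 : R); lra.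
  move: e3; rewrite expRN ltr_pdivlMr ?expR_gt0 // => e3.
  have := ler_wpM2r (expR_ge0 (n%:R / 512 : R)) k; lra.
have e5 : z i ^+ 2 <= theta ^+ 2.
  apply: le_trans hth; move: e4; rewrite ler_pdivrMr // mulrC => /(le_trans _); apply.
  by rewrite (bigD1 i) //= lerDl; apply: sumr_ge0 => j _; exact: sqr_ge0.
by rewrite -(ler_sqr) ?nnegrE // real_normK ?num_real.
Qed.

Lemma smoothed_disc_prob (theta : R) : komlos M -> 0 <= theta ->
  t * (1 + n%:R / 512) <= theta ^+ 2 ->
  ((1 - 24 / L)%:E <= P [set w | (disc (M + random_mx X w) <= theta)%R])%E.
Proof.
move=> kM th0 hth; have L0 : 0 < L by exact: lt_le_trans L_ge1.
have [D [D0 D1] [Dgood Dagr Ddet]] := good_signs d_gt0 n_gt0 kM.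
pose g b w := vbump M X t b w / vbump_mean M s t b.
have mean0 b : 0 < vbump_mean M s t b by exact: vbump_mean_gt0.
have mg b : measurable_fun setT (g b).
  by apply: measurable_funM => //; exact: measurable_vbump.
have v0 b w : 0 <= vbump M X t b w by exact/ltW/vbump_gt0.
have g0 b w : 0 <= g b w by apply: divr_ge0; [exact: v0|exact: ltW].
have intg b : (\int[P]_w (g b w)%:E = 1)%E.
  rewrite /g; under eq_integral do rewrite mulrC EFinM.
  rewrite ge0_integralZl_EFin ?invr_ge0 ?(ltW (mean0 b)) //; last 2 first.
  - by move=> w _; rewrite lee_fin v0.
  - by apply/measurable_EFinP; exact: measurable_vbump.
  by rewrite (integral_vbump M s_gt0) // -EFinM mulVf ?lt0r_neq0.
have intgg b c : (\int[P]_w (g b w * g c w)%:E = (pair_ratio M s t b c)%:E)%E.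
  under eq_integral do rewrite /g mulrACA -invfM mulrC EFinM.
  rewrite ge0_integralZl_EFin; last 4 first.
  - exact: measurableT.
  - by move=> w _; rewrite lee_fin; exact: mulr_ge0.
  - by apply/measurable_EFinP; apply: measurable_funM; exact: measurable_vbump.
  - by rewrite invr_ge0; apply: mulr_ge0; exact: ltW.
  rewrite (integral_vbump_pair M s_gt0) // -EFinM mulrCA mulVf ?mulr1 //.
  by rewrite mulf_neq0 // lt0r_neq0.
(* Each of the two exponential moments of [good_signs] contributes 3. Colourings of weight zero are
   discarded, as the ratio bound holds only for good ones. *)
have hS : \sum_b D b * (\sum_c D c * pair_ratio M s t b c) <= 1 + 6 / L.
  under eq_bigr do rewrite mulr_sumr.
  rewrite exchange_big /=.
  apply: (@le_trans _ _ (\sum_c D c * (1 + 6 / L))); last by rewrite -mulr_suml D1 mul1r.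
  apply: ler_sum => c _; under eq_bigr do rewrite mulrCA.
  rewrite -mulr_sumr; have [->|Dc] := eqVneq (D c) 0; first by rewrite !mul0r.
  rewrite ler_wpM2l //; have hc := Dgood c Dc.
  pose F b := expR (agreement b c ^+ 2 / (64 * n%:R)) + expR (detdot M b c ^+ 2 / (4096 * d%:R)).
  apply: (@le_trans _ _ (\sum_b D b * (1 + L^-1 * F b))).
    apply: ler_sum => b _; have [->|Db] := eqVneq (D b) 0; first by rewrite !mul0r.
    by rewrite ler_wpM2l // pair_ratio_le // Dgood.
  have -> : \sum_b D b * (1 + L^-1 * F b) = 1 + L^-1 * \sum_b D b * F b.
    rewrite -[X in _ = X + _]D1 mulr_sumr -big_split; apply: eq_bigr => b _ /=; ring.
  rewrite lerD2l mulrC ler_wpM2r ?invr_ge0 ?(ltW L0) //.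
  rewrite /F; under eq_bigr do rewrite mulrDr.
  by rewrite big_split /=; have := Dagr c; have := Ddet c hc; lra.
have -> : 1 - 24 / L = 1 - 4 * (6 / L) by field; exact: lt0r_neq0.
apply: (second_moment_method (conj D0 D1) mg g0 intg intgg hS).
  exact: measurable_disc_le.
move=> w hZ /=; apply/(disc_le _ th0).
have [b Db gb] : exists2 b, D b != 0 & 1 / 2 < g b w.
  apply: contrapT => nex; move: hZ; apply/negP; rewrite -leNgt.
  rewrite -[leRHS]mul1r -[X in _ <= X * _]D1 mulr_suml; apply: ler_sum => b _.
  have [->|Db] := eqVneq (D b) 0; first by rewrite !mul0r.
  by rewrite ler_wpM2l // leNgt; apply/negP => gb; apply: nex; exists b.
by exists b; exact: (rndpart_le (Dgood b Db) th0 hth gb).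
Qed.

End smoothed_discrepancy.

(** * Asymptotics *)

Section asymptotics.
Context {R : realType}.

Lemma expR1_le4 : expR 1 <= 4 :> R.
Proof.
have h : (1 / 2 : R) <= expR (- (1 / 2)) by have := expR_ge1Dx (- (1 / 2) : R); lra.
have h2 : expR (1 / 2) <= 2 :> R.
  rewrite -[X in expR X]opprK expRN invf_ple ?posrE ?expR_gt0 //.
  by apply: le_trans h; lra.
have -> : expR 1 = expR (1 / 2) * expR (1 / 2) :> R.
  by rewrite -expRD; congr expR; lra.
by have := expR_gt0 (1 / 2 : R); nra.
Qed.

Lemma powR_four_thirds (x : R) : 0 < x <= 1 ->
  let p := x `^ (4 / 3) in [/\ 0 < p, p ^+ 3 = x ^+ 4, p <= 1 & p <= x].
Proof.
move=> /andP[x0 x1] p; have p0 : 0 < p by exact: powR_gt0.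
have pE : p ^+ 3 = x ^+ 4.
  rewrite /p -powR_mulrn ?powR_ge0 // -powRrM -powR_mulrn ?(ltW x0) //.
  by congr (_ `^ _); field.
split=> //.
  rewrite -(@ler_pXn2r _ 3) ?nnegrE ?(ltW p0) // pE expr1n.
  by apply: exprn_ile1 => //; exact: ltW.
rewrite -(@ler_pXn2r _ 3) ?nnegrE ?(ltW p0) ?(ltW x0) // pE exprS.
by rewrite ler_piMl // exprn_ge0 // ltW.
Qed.

(** Turns n >> d log d into n >> d log n. With m = n / d, ln n = ln d + ln m, where ln d <= m / K by
    hypothesis and ln m = 2 ln (sqrt m) <= 2 sqrt m <= 2 m / K since sqrt m >= K. *)
Lemma mul_ln_le (d n K Om : R) : 1 <= K -> K ^+ 2 <= Om -> 0 < d -> 1 <= ln d ->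
  Om * ln d * d <= n -> d * ln n <= 3 * n / K.
Proof.
move=> K1 KOm d0 ld h; have K0 : 0 < K by lra.
have Om0 : 0 < Om by apply: lt_le_trans KOm; rewrite exprn_gt0.
pose m := n / d; have nE : n = m * d by rewrite /m divfK // lt0r_neq0.
have mOm : Om * ln d <= m by rewrite /m ler_pdivlMr.
have m1 : Om <= m by apply: le_trans mOm; rewrite ler_peMr // ltW.
have m0 : 0 < m by exact: lt_le_trans m1.
have lnd : ln d <= m / K.
  rewrite ler_pdivlMr // mulrC; apply: le_trans mOm; rewrite ler_wpM2r //; first by lra.
  by apply: le_trans KOm; rewrite expr2 ler_peMr // ltW.
pose q := Num.sqrt m; have q0 : 0 < q by rewrite sqrtr_gt0.
have qE : m = q ^+ 2 by rewrite /q sqr_sqrtr // ltW.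
have Kq : K <= q.
  rewrite -ler_sqr ?nnegrE ?(ltW q0) ?(ltW K0) // -qE.
  exact: le_trans m1.
have lnm : ln m <= 2 * (m / K).
  rewrite qE lnXn // -[ln q *+ 2]mulr_natl ler_wpM2l //; apply: le_trans (ltW (ln_sublinear q0)) _.
  by rewrite ler_pdivlMr // expr2 ler_wpM2l // ltW.
rewrite [in ln _]nE lnM ?posrE // [3 * n]mulrC nE.
have -> : m * d * 3 / K = d * (2 * (m / K) + m / K) by field; exact: lt0r_neq0.
by rewrite ler_wpM2l ?(ltW d0) // lerD.
Qed.

Lemma inv_quartic_le (d n q : R) : 4 <= d -> 4 * d <= n -> 1 <= q ->
  2 / n ^+ 4 * (1 + n / q) <= d^-1 ^+ 2.
Proof.
move=> d4 dn q1; have d0 : 0 < d by lra.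
have n0 : 0 < n by lra.
have nq : n / q <= n by rewrite ler_pdivrMr ?ler_peMr ?(ltW n0) //; lra.
have nq0 : 0 <= n / q by rewrite divr_ge0 ?(ltW n0) //; lra.
rewrite mulrAC ler_pdivrMr ?exprn_gt0 // exprVn [leRHS]mulrC ler_pdivlMr ?exprn_gt0 //.
have k1 : d ^+ 2 <= n ^+ 2 by apply: lerXn2r; rewrite ?nnegrE ?(ltW d0) ?(ltW n0) //; lra.
have k2 : 2 * (1 + n / q) <= n ^+ 2 by nra.
have -> : n ^+ 4 = n ^+ 2 * n ^+ 2 by ring.
by apply: ler_pM; rewrite ?exprn_ge0 ?(ltW d0) // mulr_ge0 // addr_ge0.
Qed.

Lemma smoothed_disc_rate {disp : measure_display} {T : measurableType disp}
    (P : probability T R) (d n : nat) (M : 'M[R]_(d, n))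
    (X : 'I_d * 'I_n -> {RV P >-> R}) (sigma K : R) :
  let Om := n%:R * sigma `^ (4 / 3) / (d%:R * ln d%:R) in
  (4 <= d)%N -> 0 < sigma <= 1 -> komlos M ->
  iid_gaussian (sigma / Num.sqrt d%:R) X -> 16 * 4096 <= K -> K ^+ 2 <= Om ->
  ((1 - 24 / (Om / 2000))%:E <=
     P [set w | (disc (M + random_mx X w) <= d%:R^-1)%R])%E.
Proof.
move=> Om d4 sig01 kM iidX K8 KOm.
have [p0 p3 p1 ps] := powR_four_thirds sig01; move: (sig01) => /andP[sig0 sig1].
set p := sigma `^ (4 / 3) in Om KOm p0 p3 p1 ps *.
pose dd : R := d%:R; pose nn : R := n%:R.
have dd4 : 4 <= dd by rewrite /dd ler_nat.
have dd0 : 0 < dd by exact: lt_le_trans dd4.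
have p4096 : (0 : R) < 16 * 4096 by rewrite -natrM ltr0n.
have K0 : 0 < K by exact: lt_le_trans K8.
have K1 : 1 <= K by apply: le_trans K8; rewrite -natrM ler1n.
have K2000 : 2000 <= K by apply: le_trans K8; rewrite -natrM ler_nat.
(* 73 = 3 * 3 + 64: the prefactor costs 3 d ln n <= 9 n / K, and the exponential costs 64 n / K. *)
have K73 : 73 / K <= 512^-1.
  rewrite ler_pdivrMr // mulrC ler_pdivlMr ?ltr0n // -natrM.
  by apply: le_trans K8; rewrite -natrM ler_nat.
clear K8 p4096.
have ld1 : 1 <= ln dd.
  by rewrite -ler_expR lnK ?posrE //; exact: le_trans expR1_le4 dd4.
have Om1 : K <= Om by apply: le_trans KOm; rewrite expr2 ler_peMr // ltW.
have Om0 : 0 < Om by exact: lt_le_trans Om1.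
have ld0 : 0 < ln dd by exact: lt_le_trans ld1.
have Om_ge1 : 1 <= Om by exact: le_trans Om1.
have npE : nn * p = Om * ln dd * dd.
  by rewrite /Om -/dd -/nn; field; rewrite !lt0r_neq0.
have nOm : Om * ln dd * dd <= nn.
  rewrite -npE; have nn0 : 0 <= nn by exact: ler0n.
  by rewrite ler_piMr.
have Omdd : Om * dd <= nn.
  apply: le_trans nOm; rewrite ler_wpM2r ?(ltW dd0) //.
  by rewrite ler_peMr // ltW.
have nn0 : 0 < nn by apply: lt_le_trans Omdd; rewrite mulr_gt0.
have nnd : 4 * dd <= nn.
  apply: le_trans Omdd; rewrite ler_wpM2r ?(ltW dd0) //; apply: le_trans Om1.
  by apply: le_trans K2000; rewrite ler_nat.
have n0 : (0 < n)%N by move: nn0; rewrite /nn ltr0n.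
have n4 : (4 <= n)%N.
  rewrite -(ler_nat R); apply: le_trans nnd; rewrite ler_peMr //.
  by apply: le_trans dd4; rewrite ler1n.
pose s := sigma / Num.sqrt dd; pose t := 2 / nn ^+ 4; pose L := Om / 2000.
have s0 : 0 < s by rewrite divr_gt0 // sqrtr_gt0.
have s2 : s ^+ 2 = sigma ^+ 2 / dd by rewrite exprMn exprVn sqr_sqrtr // ltW.
have n40 : 0 < nn ^+ 4 by rewrite exprn_gt0.
have t0 : 0 < t by rewrite divr_gt0.
have p2000 : (0 : R) < 2000 by rewrite ltr0n.
have L1 : 1 <= L by rewrite /L (ler_pdivlMr _ _ p2000) mul1r; exact: le_trans Om1.
have LOm : 2000 * L = Om by rewrite /L mulrC (divfK (lt0r_neq0 p2000)).
have c1 : 512 * L * d%:R <= n%:R.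
  rewrite -/dd -/nn; apply: le_trans Omdd; rewrite ler_wpM2r ?(ltW dd0) // -LOm.
  by rewrite ler_wpM2r ?(le_trans ler01 L1) // ler_nat.
clear p2000.
pose a := @halfvar R n s t.
have a0 : 0 < a by exact: halfvar_gt0.
have aE : a = nn ^- 4 + sigma ^+ 2 * nn / dd.
  rewrite /a /halfvar s2 /t -/nn; field; rewrite !lt0r_neq0 //.
have a1 : sigma ^+ 2 * nn / dd <= a by rewrite aE lerDr invr_ge0 ltW.
have b0 : 0 < sigma ^+ 2 * nn / dd by rewrite !mulr_gt0 ?exprn_gt0 ?invr_gt0.
have pO : Om <= nn * p / dd.
  by rewrite ler_pdivlMr // npE ler_wpM2r ?(ltW dd0) // ler_peMr // ltW.
have c2 : (2000 * L) ^+ 2 * d%:R <= n%:R * a ^+ 2.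
  rewrite LOm -/dd -/nn.
  apply: (@le_trans _ _ (nn * (sigma ^+ 2 * nn / dd) ^+ 2)); last first.
    by rewrite ler_wpM2l ?(ltW nn0) // ler_sqr ?nnegrE ?(ltW a0) ?(ltW b0).
  (* Here p^3 = sigma^4 is used: the condition on a becomes a lower bound on the cube of n
     sigma^(4/3) / d, which is at least Om. *)
  have -> : nn * (sigma ^+ 2 * nn / dd) ^+ 2 = (nn * p / dd) ^+ 3 * dd.
    have -> : (nn * p / dd) ^+ 3 = nn ^+ 3 * p ^+ 3 / dd ^+ 3 by field; exact: lt0r_neq0.
    by rewrite p3; field; exact: lt0r_neq0.
  rewrite ler_wpM2r ?(ltW dd0) //; apply: (@le_trans _ _ (Om ^+ 3)).
    by rewrite [leRHS]exprS; apply: ler_peMl; [rewrite exprn_ge0 // ltW|].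
  by apply: lerXn2r => //; rewrite nnegrE; [exact: ltW|exact: le_trans (ltW Om0) pO].
have c3 : Num.sqrt (2 * a / t) ^+ d * expR (64 * d%:R / a) <= expR (n%:R / 512).
  (* With t = 2 / n^4, 2 a / t = 1 + sigma^2 n^5 / d <= n^6, so the d-th power costs only exp (3 d
     ln n). *)
  have f1 : Num.sqrt (2 * a / t) <= nn ^+ 3.
    have -> : nn ^+ 3 = Num.sqrt ((nn ^+ 3) ^+ 2).
      by rewrite sqrtr_sqr ger0_norm // exprn_ge0 // ltW.
    rewrite ler_wsqrtr //.
    have -> : 2 * a / t = 1 + sigma ^+ 2 * (nn ^+ 5 / dd).
      by rewrite aE /t; field; rewrite !lt0r_neq0.
    have g1 : sigma ^+ 2 * (nn ^+ 5 / dd) <= nn ^+ 5.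
      rewrite mulrA ler_pdivrMr // mulrC ler_wpM2l ?exprn_ge0 ?(ltW nn0) //.
      apply: (@le_trans _ _ 1); last by apply: le_trans dd4; rewrite ler1n.
      by apply: exprn_ile1 => //; exact: ltW.
    have nn2 : 2 <= nn by rewrite /nn ler_nat; apply: leq_trans n4.
    have g2 : 1 <= nn ^+ 5 by apply: exprn_ege1; apply: le_trans nn2; rewrite ler1n.
    have -> : (nn ^+ 3) ^+ 2 = nn * nn ^+ 5 by ring.
    apply: (@le_trans _ _ (2 * nn ^+ 5)); last by rewrite ler_wpM2r ?exprn_ge0 ?(ltW nn0) //.
    by rewrite (_ : 2 * nn ^+ 5 = nn ^+ 5 + nn ^+ 5) ?lerD //; ring.
  have f2 : Num.sqrt (2 * a / t) ^+ d <= expR (3 * (dd * ln nn)).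
    have -> : expR (3 * (dd * ln nn)) = (nn ^+ 3) ^+ d.
      rewrite (_ : 3 * (dd * ln nn) = d%:R * (3%:R * ln nn)); last by rewrite -/dd; ring.
      by rewrite !expRM_natl lnK.
    by apply: lerXn2r; rewrite ?nnegrE ?sqrtr_ge0 ?exprn_ge0 ?(ltW nn0).
  have f3 : dd * ln nn <= 3 * nn / K.
    exact: (mul_ln_le K1 KOm dd0 ld1 nOm).
  have f4 : 64 * dd / a <= 64 * (nn / K).
    rewrite -mulrA ler_wpM2l // ler_pdivrMr //.
    apply: (@le_trans _ _ (nn / K * (sigma ^+ 2 * nn / dd))); last first.
      by rewrite ler_wpM2l // ltW // divr_gt0.
    have -> : nn / K * (sigma ^+ 2 * nn / dd) = (nn * sigma / dd) ^+ 2 * dd / K.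
      by field; rewrite !lt0r_neq0.
    rewrite ler_pdivlMr // mulrC ler_wpM2r ?(ltW dd0) //.
    have h1 : Om <= nn * sigma / dd.
      by apply: le_trans pO _; rewrite ler_wpM2r ?invr_ge0 ?(ltW dd0) // ler_wpM2l.
    apply: le_trans Om1 _; apply: le_trans (h1) _; rewrite expr2.
    by apply: ler_peMr; [exact: le_trans (ltW Om0) h1|exact: le_trans Om_ge1 h1].
  apply: (@le_trans _ _ (expR (3 * (dd * ln nn)) * expR (64 * (nn / K)))).
    by apply: ler_pM; rewrite ?exprn_ge0 ?sqrtr_ge0 ?expR_ge0 ?ler_expR.
  rewrite -expRD ler_expR -/nn.
  have -> : 3 * (dd * ln nn) + 64 * (nn / K) = 3 * (dd * ln nn) + 64 * nn / K.
    by rewrite [64 * (nn / K)]mulrA.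
  apply: (@le_trans _ _ (nn * (73 / K))); last by rewrite ler_wpM2l // ltW.
  have -> : nn * (73 / K) = 3 * (3 * nn / K) + 64 * nn / K by field; exact: lt0r_neq0.
  by rewrite lerD2r ler_wpM2l.
have th0 : 0 <= d%:R^-1 :> R by rewrite invr_ge0 ler0n.
have c4 : t * (1 + n%:R / 512) <= (d%:R^-1) ^+ 2.
  by apply: (inv_quartic_le dd4 nnd); rewrite ler1n.
have d0 : (0 < d)%N by exact: leq_trans d4.
exact: (smoothed_disc_prob d0 n0 s0 t0 iidX L1 c1 c2 c3 kM th0 c4).
Qed.

End asymptotics.

Theorem theorem1p1 (R : realType) :
  exists2 c : R, 0 < c &
    forall (sigma : nat -> R) (n : nat -> nat)
      (M : forall d : nat, 'M[R]_(d, n d))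
      (disp : nat -> measure_display)
      (T : forall d : nat, measurableType (disp d))
      (P : forall d : nat, probability (T d) R)
      (X : forall d : nat, 'I_d * 'I_(n d) -> {RV (P d) >-> R}),
    (forall d, (2 <= d)%N -> 0 < sigma d <= 1) ->
    (forall d, (2 <= d)%N -> (0 < n d)%N) ->
    (n d)%:R * sigma d `^ (4 / 3) / (d%:R * ln d%:R) @[d --> \oo] --> +oo ->
    (forall d, (2 <= d)%N -> komlos (M d)) ->
    (forall d, (2 <= d)%N ->
      iid_gaussian (sigma d / Num.sqrt d%:R) (X d)) ->
    P d [set w | disc (M d + random_mx (X d) w) <= d%:R `^ (- c)]
      @[d --> \oo] --> 1%E.
Proof.
exists 1 => // sigma n M disp T P X hsig hn hOm hM hX.
set Om := (fun d : nat => _) in hOm.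
have OmV : (Om d)^-1 @[d --> \oo] --> (0 : R).
  apply/gtr0_cvgV0 => //; move/cvgryPgt : hOm => /(_ 0); exact.
apply: (squeeze_cvge (f := fun d => (1 - 24 / (Om d / 2000))%:E) (h := cst 1%E)).
- near=> d.
  have d4 : (4 <= d)%N by near: d; exact: nbhs_infty_ge.
  have d2 : (2 <= d)%N by exact: leq_trans d4.
  have KOm : (16 * 4096) ^+ 2 <= Om d.
    by near: d; move/cvgryPge : hOm => /(_ ((16 * 4096) ^+ 2)).
  rewrite powR_inv1 ?ler0n //.
  rewrite (smoothed_disc_rate d4 (hsig d d2) (hM d d2) (hX d d2) (lexx _) KOm) /=.
  by apply: probability_le1; apply: measurable_disc_le; rewrite invr_ge0 ler0n.
- apply: cvg_EFin; first by near=> d.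
  have lim : 1 - (Om d)^-1 * (2000 * 24) @[d --> \oo] --> (1 - 0 * (2000 * 24) : R).
    by apply: cvgB; [exact: cvg_cst|apply: cvgM => //; exact: cvg_cst].
  rewrite mul0r subr0 in lim; apply: cvg_trans lim; apply: near_eq_cvg.
  apply: nearW => d /=; congr (1 - _).
  by rewrite [in RHS]invf_div [RHS]mulrA [RHS]mulrC [24 * 2000]mulrC.
- exact: cvg_cst.
Unshelve. all: by end_near.
Qed.
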